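(* Let $\Omega=V\bigwedge_{i=1}^n\big(dx_i+\sum_j\beta_{ij}dy_j\big)$ with $\beta_{ij}=b_{ij}+ig^{ij}$ symmetric, $(g^{ij})=(g_{ij})^{-1}$ positive definite and $V=\sqrt{\det(g_{ij})}$. Suppose $d\Omega=0$ and the connection $\nabla_b$ is flat. Then the metric $g$ is flat along the fibres.
   Context: $f:X\to B$ is an integral special Lagrangian $T^n$-fibration of a compact Calabi–Yau $n$-fold $X$ with a Lagrangian section, and $f^\#:X^\#\to B$ is its restriction to the complement $X^\#$ of the critical locus. Then $X^\#=\mathcal{T}_B^*/\Lambda$, where $\Lambda\subseteq\mathcal{T}_B^*$ is a Lagrangian family of discrete subgroups (lattices over the dense open set $B_0\subseteq B$ over which $f$ is smooth, so the fibres over $B_0$ are compact $n$-tori), and the symplectic form is $\omega=\sum_idx_i\wedge dy_i$ in canonical coordinates ($y_1,\dots,y_n$ local coordinates on $B$, $x_1,\dots,x_n$ fibre coordinates of the covector $\sum x_idy_i$). The $b_{ij},g_{ij}$ are real $C^\infty$ functions of $(x,y)$, given in each such coordinate system so that $\Omega$ is globally defined; the metric along the fibres is $\sum g_{ij}dx_idx_j$. The matrix $b$ defines the Ehresmann connection $\nabla_b$ on $f^\#$ with horizontal subspaces spanned by $\partial/\partial y_j-\sum_ib_{ij}\partial/\partial x_i$, $1\le j\le n$; $\nabla_b$ flat means its curvature $F_b$ vanishes, equivalently the horizontal distribution is integrable. (Explicitly, $F_b=d_yb-\frac12[b,b]$, with $b=\sum b_{ij}dy_j\otimes\partial/\partial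 x_i$, $d_yb=\sum\frac{\partial b_{ij}}{\partial y_k}dy_k\wedge dy_j\otimes\frac{\partial}{\partial x_i}$, and $[b,b]=\sum_{l,m}[b_l,b_m]dy_l\wedge dy_m$ where $b_l=\sum_ib_{il}\partial/\partial x_i$ and $[\cdot,\cdot]$ is the Lie bracket along fibres.) *)

(* Defs.v *)
From HB Require Import structures.
From mathcomp Require Import all_boot all_order all_algebra.
From mathcomp Require Import all_classical all_reals all_analysis.
From mathcomp Require Import complex.

Set Implicit Arguments.
Unset Strict Implicit.
Unset Printing Implicit Defensive.

Import Order.TTheory GRing.Theory Num.Theory.
Import numFieldNormedType.Exports.

Local Open Scope classical_set_scope.
Local Open Scope ring_scope.

Section Calculus.
Variables (R : realType) (V W : normedModType R).

Definition iter_derive (f : V -> W) (vs : seq V) : V -> W :=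
  foldl (fun h v => fun p => 'D_v h p) f vs.

(* C^oo on D, to be used for open D: every iterated directional derivative
   exists and is differentiable (hence continuous) at every point of D. *)
Definition smooth_on (D : set V) (f : V -> W) : Prop :=
  forall (vs : seq V) (p : V), D p -> differentiable (iter_derive f vs) p.

End Calculus.

Section Forms.
Variables (R : realType) (V : normedModType R).

(* A complex-valued k-form, evaluated at a point on k tangent vectors. *)
Definition form (k : nat) : Type := V -> ('I_k -> V) -> R[i].

Definition derivec (F : V -> R[i]) (v p : V) : R[i] :=
  Complex ('D_v (fun q => complex.Re (F q)) p)
          ('D_v (fun q => complex.Im (F q)) p).

(* The invariant formula for d on constant vector fields, whose brackets
   vanish. *)
Definition extd (k : nat) (w : form k) : form k.+1 := fun p v =>
  \sum_(i < k.+1)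
    (-1) ^+ i * derivec (fun q => w q (fun j => v (lift i j))) (v i) p.

Definition pullback (k : nat) (F : V -> V) (w : form k) : form k :=
  fun p v => w (F p) (fun i => 'D_(v i) F p).

(* (t_1 /\ ... /\ t_k) (v_1, ..., v_k) = det (t_i (v_j)) *)
Definition wedge (k : nat) (t : 'I_k -> V -> V -> R[i]) : form k :=
  fun p v => \det (\matrix_(i, j) t i p (v j)).

End Forms.

(* A C^oo atlas, not assumed maximal; chart_inv a is only meaningful on
   chart a @` chart_dom a. *)
Record atlas (R : realType) (n : nat) (B : topologicalType) := Atlas {
  chart_ix :> Type;
  chart_dom : chart_ix -> set B;
  chart : chart_ix -> B -> 'rV[R]_n;
  chart_inv : chart_ix -> 'rV[R]_n -> B;
  chart_dom_open : forall a, open (chart_dom a);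
  chart_img_open : forall a, open (chart a @` chart_dom a);
  chart_cover : forall q : B, exists a, chart_dom a q;
  chartK : forall a q, chart_dom a q -> chart_inv a (chart a q) = q;
  chart_cont : forall a q, chart_dom a q -> {for q, continuous (chart a)};
  chart_inv_cont : forall a y, (chart a @` chart_dom a) y ->
    {for y, continuous (chart_inv a)};
  chart_trans_smooth : forall a a',
    smooth_on (chart a @` (chart_dom a `&` chart_dom a'))
      (fun y => chart a' (chart_inv a y))
}.

(* The point (x, y) stands for the covector \sum_i x_i dy_i at y. *)
Notation phase R n := ('rV[R]_n * 'rV[R]_n)%type (only parsing).

Section Cotangent.
Variables (R : realType) (n : nat) (B : topologicalType) (A : atlas R n B).

Local Notation E := (phase R n).

Definition chart_img (a : A) : set 'rV[R]_n := chart a @` chart_dom a.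

Definition overlap (a a' : A) : set 'rV[R]_n :=
  chart a @` (chart_dom a `&` chart_dom a').

Definition cot_dom (a : A) : set E := [set p | chart_img a p.2].

Definition trans (a a' : A) (y : 'rV[R]_n) : 'rV[R]_n :=
  chart a' (chart_inv a y).

(* \sum_j x_j dy_j = \sum_i x'_i dy'_i with x'_i = \sum_j x_j (dy_j / dy'_i);
   the entry i j of jacobian f is the i-th partial derivative of f_j. *)
Definition cot_trans (a a' : A) (p : E) : E :=
  (p.1 *m (jacobian (trans a' a) (trans a a' p.2))^T, trans a a' p.2).

(* omega = \sum_i dx_i /\ dy_i *)
Definition symplectic (u v : E) : R :=
  \sum_i (u.1 0 i * v.2 0 i - v.1 0 i * u.2 0 i).

Definition lagrangian_section (W : set 'rV[R]_n) (s : 'rV[R]_n -> 'rV[R]_n) :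
    Prop :=
  let S := fun y => (s y, y) : E in
  smooth_on W s /\
  forall y, W y -> forall u v, symplectic ('D_u S y) ('D_v S y) = 0.

(* Lambda, given in each cotangent chart, is a closed Lagrangian submanifold of
   T^*B, etale over B, meeting every fibre in a discrete subgroup; closedness
   makes the quotient T^*B / Lambda Hausdorff. *)
Record lagrangian_family (Lam : A -> set E) : Prop := LagrangianFamily {
  lam_sub : forall a, Lam a `<=` cot_dom a;
  lam_trans : forall a a' p, overlap a a' p.2 ->
    Lam a p <-> Lam a' (cot_trans a a' p);
  lam_zero : forall a y, chart_img a y -> Lam a (0, y);
  lam_subgroup : forall a x x' y,
    Lam a (x, y) -> Lam a (x', y) -> Lam a (x - x', y);
  lam_discrete : forall a y, chart_img a y ->
    \forall x \near (0 : 'rV[R]_n), Lam a (x, y) -> x = 0;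
  lam_lagrangian : forall a p, Lam a p ->
    exists (W : set 'rV[R]_n) (s : 'rV[R]_n -> 'rV[R]_n),
      [/\ open W, W p.2, W `<=` chart_img a, lagrangian_section W s &
          \forall q \near p, Lam a q <-> q.1 = s q.2];
  lam_closed : forall a p, cot_dom a p -> closure (Lam a) p -> Lam a p
}.

Definition is_lattice (L : set 'rV[R]_n) : Prop :=
  exists2 M : 'M[R]_n, M \in unitmx &
    L = [set x | exists k : 'rV[int]_n, x = map_mx intr k *m M].

Definition lattice_over (Lam : A -> set E) (B0 : set B) : Prop :=
  forall a q, chart_dom a q -> B0 q ->
    is_lattice [set x | Lam a (x, chart a q)].

Definition translate (s : 'rV[R]_n -> 'rV[R]_n) (p : E) : E :=
  (p.1 + s p.2, p.2).

(* A form on X^# = T^*B / Lambda, given by its expressions in all canonical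
   coordinate systems: they agree under changes of the coordinates y and of
   the local lift of X^# to T^*B. For Omega below, whose coefficient V is
   positive, agreement on overlaps requires an oriented atlas. *)
Definition global_form (k : nat) (Lam : A -> set E)
    (w : A -> form E k) : Prop :=
  (forall a a' p v, overlap a a' p.2 ->
     pullback (cot_trans a a') (w a') p v = w a p v) /\
  (forall a (W : set 'rV[R]_n) (s : 'rV[R]_n -> 'rV[R]_n),
     open W -> W `<=` chart_img a -> smooth_on W s ->
     (forall y, W y -> Lam a (s y, y)) ->
     forall p v, W p.2 -> pullback (translate s) (w a) p v = w a p v).

End Cotangent.

Section HolomorphicForm.
Variables (R : realType) (n : nat).
Local Notation E := (phase R n).
Implicit Types (b g : E -> 'M[R]_n) (p : E).

Definition pos_def (M : 'M[R]_n) : Prop :=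
  forall u : 'rV[R]_n, u != 0 -> 0 < (u *m M *m u^T) 0 0.

Definition beta b g p : 'M[R[i]]_n :=
  \matrix_(i, j) Complex (b p i j) (invmx (g p) i j).

(* dx_i + \sum_j beta_ij dy_j *)
Definition theta b g (i : 'I_n) p (v : E) : R[i] :=
  (v.1 0 i)%:C%C + \sum_j beta b g p i j * (v.2 0 j)%:C%C.

Definition Omega b g : form E n := fun p v =>
  (Num.sqrt (\det (g p)))%:C%C * wedge (theta b g) p v.

(* The vertical vector field b_l = \sum_i b_il d/dx_i. *)
Definition vert b (l : 'I_n) p : 'rV[R]_n := \row_i b p i l.

Definition fibre_bracket (u w : E -> 'rV[R]_n) p : 'rV[R]_n :=
  'D_((u p, 0) : E) w p - 'D_((w p, 0) : E) u p.

(* The value of F_b = d_y b - [b, b] / 2 on (d/dy_k, d/dy_j); the factor 1/2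
   disappears because dy_l /\ dy_m and dy_m /\ dy_l both contribute. *)
Definition connection_curvature b (k j : 'I_n) p : 'rV[R]_n :=
  'D_((0, delta_mx 0 k) : E) (vert b j) p - 'D_((0, delta_mx 0 j) : E) (vert b k) p
  - fibre_bracket (vert b k) (vert b j) p.

End HolomorphicForm.

(* Levi-Civita connection and Riemann curvature of a metric h on R^n. *)
Section Riemann.
Variables (R : realType) (n : nat) (h : 'rV[R]_n -> 'M[R]_n).

Definition partial (f : 'rV[R]_n -> R) (i : 'I_n) (x : 'rV[R]_n) : R :=
  'D_(delta_mx 0 i) f x.

Definition christoffel (k i j : 'I_n) (x : 'rV[R]_n) : R :=
  2^-1 * \sum_l invmx (h x) k l *
    (partial (fun z => h z j l) i x + partial (fun z => h z i l) j x
     - partial (fun z => h z i j) l x).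

Definition riemann (l k i j : 'I_n) (x : 'rV[R]_n) : R :=
  partial (christoffel l j k) i x - partial (christoffel l i k) j x
  + \sum_m (christoffel l i m x * christoffel m j k x
            - christoffel l j m x * christoffel m i k x).

Definition flat_metric : Prop := forall l k i j x, riemann l k i j x = 0.

End Riemann.

(* Main.v *)
(* Write h = g^-1. The components of d Omega = 0 on (d/dy_j, d/dx_1, ..., d/dx_n)
   give sum_k d_k (V h_kj) = 0 along the fibres, where d_k = d/dx_k; those on two
   base vectors, combined with the flatness of the connection, say that the
   vector fields sum_i h_ik d_i commute. The second fact means that d_l g_ij is
   symmetric in all three indices; with V = sqrt (det g) the first then forces
   V to be constant along the fibres, that is, tr (h d_c g) = 0 for all c.
   Consequently the divergence of h grad g_cc is
   tr (h (d_c g) h (d_c g)), which is nonnegative and vanishes only where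
   d_c g = 0. Over B0 the metric is periodic for a lattice, because Omega
   descends to T^*B / Lambda; a periodic vector field with nonnegative
   divergence has zero divergence, so g is constant on these fibres. By density
   of B0 and continuity, g is constant on every fibre. *)

Require Import Defs.
From HB Require Import structures.
From mathcomp Require Import all_boot all_order all_algebra.
From mathcomp Require Import all_classical all_reals all_analysis.
From mathcomp Require Import complex.
From mathcomp Require Import perm.
From mathcomp Require Import ring.

Set Implicit Arguments.
Unset Strict Implicit.
Unset Printing Implicit Defensive.

Import Order.TTheory GRing.Theory Num.Theory.
Import numFieldNormedType.Exports.

Local Open Scope classical_set_scope.
Local Open Scope ring_scope.

(** * Determinants *)

(** Total symmetry of the derivatives says that on a fibre [g] is the Hessian of a potential, and
    constancy of [V] is then a Monge-Ampere equation for it. Hence the choice of [g_cc]: it is a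
    second derivative of the potential, and differentiating the equation twice in that direction
    gives its linearisation, which is in divergence form, applied to [g_cc], with a quadratic
    remainder of one sign. The potential need not descend to the torus, so the argument stays with
    [g] itself. On two base vectors the real part of d Omega contains the brackets of the columns of
    [b] minus those of the columns of [g^-1], because [i^2 = -1]. Flatness disposes of the former
    together with the derivatives of [b] along the base, and the equations on one base vector
    dispose of all derivatives of [V]. The divergence theorem on the torus enters without
    integration: increments of a periodic field along lattice vectors telescope on finite grids, and
    compactness compares them with derivatives. *)

Section Determinants.
Variable R : comNzRingType.

(** Sylvester's determinant identity: multiplying the bordered matrix [B] by one and the same
    unipotent matrix on the right and on the left exposes the two sides. *)
Lemma det_add_mulmxC m n (U : 'M[R]_(m, n)) (W : 'M[R]_(n, m)) :
  \det (1%:M + U *m W) = \det (1%:M + W *m U).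
Proof.
set B := block_mx 1%:M (- W) U 1%:M.
have E1 : B *m block_mx 1%:M W 0 1%:M = block_mx 1%:M 0 U (1%:M + U *m W).
  rewrite mulmx_block !mulmx1 !mul1mx !mulmx0 !addr0 subrr.
  by rewrite addrC.
have E2 : block_mx 1%:M W 0 1%:M *m B = block_mx (1%:M + W *m U) 0 U 1%:M.
  rewrite mulmx_block !mulmx1 !mul1mx !mul0mx !add0r.
  by rewrite addNr.
have <- : \det B = \det (1%:M + U *m W).
  have := congr1 determinant E1; rewrite det_mulmx det_ublock det_lblock.
  by rewrite !det1 mulr1 mul1r mulr1.
have := congr1 determinant E2; rewrite det_mulmx det_ublock det_lblock.
by rewrite !det1 !mul1r mulr1.
Qed.

Lemma det_block_scalar2 (x y z w : R) :
  \det (block_mx x%:M y%:M z%:M w%:M : 'M[R]_(1 + 1)) = x * w - y * z.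
Proof.
set A := block_mx _ _ _ _.
have El : (0 : 'I_(1 + 1)) = lshift 1 0 by exact: val_inj.
have Er : lift (0 : 'I_2) 0 = rshift 1 (0 : 'I_1) by exact: val_inj.
have El' : lift (rshift 1 (0 : 'I_1)) 0 = lshift 1 (0 : 'I_1) by exact: val_inj.
have [A00 A01 A10 A11] : [/\ A (lshift 1 0) (lshift 1 0) = x,
    A (lshift 1 0) (rshift 1 0) = y, A (rshift 1 0) (lshift 1 0) = z
    & A (rshift 1 0) (rshift 1 0) = w].
  by rewrite /A block_mxEul block_mxEdr block_mxEur block_mxEdl !mxE.
rewrite (expand_det_row _ 0) big_ord_recl big_ord1 /cofactor !det_mx11.
clearbody A; rewrite !mxE -[ord0]/(0 : 'I_2) Er El' El A00 A01 A10 A11.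
by rewrite expr0 expr1 mul1r mulN1r mulrN.
Qed.

Let scalar_mxD n (x y : R) : (x + y)%:M = x%:M + y%:M :> 'M[R]_n.
Proof. exact: raddfD. Qed.

Let scalar_mxN n (x : R) : (- x)%:M = - (x%:M) :> 'M[R]_n.
Proof. exact: raddfN. Qed.

(** The matrix is the identity with column [i] replaced by [c]; as a rank-one perturbation it falls
    under Sylvester's identity. *)
Lemma det_col_replaced n (c : 'cV[R]_n) (i : 'I_n) :
  \det (1%:M + (c - delta_mx i 0) *m delta_mx 0 i) = c i 0.
Proof.
rewrite det_add_mulmxC -rowE [X in _ + X]mx11_scalar -scalar_mxD det_scalar1.
by rewrite !mxE !eqxx /= addrCA subrr addr0.
Qed.

(* Its coefficient of an entry of the top row is the signed minor that the
   definition of d attaches to the corresponding vector. *)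
Lemma det_bordered1 n (a0 : R) (a : 'rV[R]_n) (c : 'cV[R]_n) :
  \det (block_mx a0%:M a c 1%:M) = a0 - (a *m c) 0 0.
Proof.
have -> : block_mx a0%:M a c 1%:M =
    block_mx 1%:M a 0 1%:M *m block_mx (a0 - (a *m c) 0 0)%:M 0 c 1%:M.
  rewrite mulmx_block !mulmx1 !mul1mx !mul0mx !add0r.
  have ac := mx11_scalar (a *m c); set t := (a *m c) 0 0 in ac *.
  by rewrite ac -scalar_mxD subrK.
by rewrite det_mulmx det_ublock det_lblock !det1 det_scalar1 !mul1r mulr1.
Qed.

(** The lower right block is the identity with column [i] replaced by [d]. Once the top row is
    cleared outside the corner and position [i], only two columns differ from those of the identity,
    and Sylvester's identity leaves a 2 by 2 determinant. *)
Lemma det_bordered2 n (a0 : R) (a : 'rV[R]_n) (c d : 'cV[R]_n) (i : 'I_n) :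
  \det (block_mx a0%:M a c (1%:M + (d - delta_mx i 0) *m delta_mx 0 i)) =
  (a0 - (a *m c) 0 0) * d i 0 - (a 0 i - (a *m d) 0 0) * c i 0.
Proof.
set D := 1%:M + _.
set al := a0 - _; set ga := a 0 i - _.
have aD : a *m D = a - (ga *: delta_mx 0 i).
  rewrite mulmxDr mulmx1 mulmxA mulmxBr -colE; congr (_ + _).
  have ad := mx11_scalar (a *m d); have ai := mx11_scalar (col i a).
  rewrite mxE in ai; rewrite /ga; set t := (a *m d) 0 0 in ad *.
  by rewrite ad ai -scaleNr opprB -scalar_mxN -scalar_mxD mul_scalar_mx.
have -> : block_mx a0%:M a c D =
    block_mx 1%:M a 0 1%:M *m block_mx al%:M (ga *: delta_mx 0 i) c D.
  rewrite mulmx_block !mul1mx !mul0mx !add0r aD [_ + (a - _)]addrC subrK.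
  have ac := mx11_scalar (a *m c); rewrite /al; set t := (a *m c) 0 0 in ac *.
  by rewrite ac -scalar_mxD subrK.
have -> : block_mx al%:M (ga *: delta_mx 0 i) c D = 1%:M +
    block_mx (al - 1)%:M ga%:M c (d - delta_mx i 0) *m
    block_mx 1%:M 0 0 (delta_mx 0 i) :> 'M[R]_(1 + n).
  rewrite mulmx_block !mulmx1 !mulmx0 !addr0 !add0r scalar_mx_block.
  rewrite add_block_mx !add0r -!scalar_mxD [1 + _]addrC subrK.
  by rewrite mul_scalar_mx.
rewrite det_mulmx det_ublock !det1 !mul1r det_add_mulmxC.
rewrite mulmx_block !mul1mx !mul0mx !addr0 !add0r scalar_mx_block.
rewrite add_block_mx !add0r -!scalar_mxD addrC subrK.
rewrite -!rowE [row i c]mx11_scalar [row i (d - _)]mx11_scalar -scalar_mxD.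
by rewrite det_block_scalar2 !mxE !eqxx /= [1 + _]addrC subrK.
Qed.
End Determinants.
(** * Positive definite matrices *)

Section PositiveDefinite.
Variable R : realType.

(** Cholesky factorisation, by induction on the Schur complement of the first diagonal entry. *)
Lemma pos_def_gram n (M : 'M[R]_n) : M^T = M -> pos_def M ->
  exists S : 'M[R]_n, M = S *m S^T.
Proof.
elim: n M => [|n IH] M; first by exists 0; apply/matrixP => -[].
rewrite -[n.+1]/(1 + n)%N in M *; rewrite -(submxK M).
set a := ulsubmx M; set r := ursubmx M; set D := drsubmx M.
rewrite tr_block_mx => /eq_block_mx[_ _ rE DT] Mpos.
rewrite -rE in Mpos *.
have a_gt0 : 0 < a 0 0.
  have /Mpos : row_mx (1 : 'M[R]_1) (0 : 'rV_n) != 0.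
    apply/negP => /eqP/matrixP/(_ 0 (lshift n 0)).
    by rewrite row_mxEl !mxE eqxx => /eqP; rewrite oner_eq0.
  rewrite mul_row_block tr_row_mx mul_row_col !mul0mx !mul1mx !addr0.
  by rewrite trmx1 trmx0 mulmx1 mulmx0 addr0.
have DsT : (D - (a 0 0)^-1 *: (r^T *m r))^T = D - (a 0 0)^-1 *: (r^T *m r).
  by rewrite linearB linearZ /= trmx_mul trmxK DT.
have Dspos : pos_def (D - (a 0 0)^-1 *: (r^T *m r)).
  (* [t] completes the square: it makes the first block of [row_mx t w *m M] vanish, so that the
     form of [M] at this vector is the form of the Schur complement at [w]. *)
  move=> w wne0; pose t := - (a 0 0)^-1 *: (w *m r^T).
  have /Mpos : row_mx t w != 0.
    apply: contra wne0 => /eqP tw0.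
    by apply/eqP; rewrite -(row_mxKr t w) tw0 linear0.
  rewrite mul_row_block tr_row_mx mul_row_col.
  suff -> : (t *m a + w *m r^T) = 0.
    rewrite mul0mx add0r => /lt_le_trans; apply; rewrite /t le_eqVlt.
    apply/orP; left; apply/eqP; congr (fun_of_matrix (_ *m _) 0 0).
    by rewrite mulmxBr -scalemxAr -scalemxAl scaleNr mulmxA addrC.
  rewrite [a]mx11_scalar mul_mx_scalar /t scalerA mulrN divff ?gt_eqF//.
  by rewrite scaleN1r addNr.
have [S SE] := IH _ DsT Dspos.
pose s := Num.sqrt (a 0 0).
have s_neq0 : s != 0 by rewrite gt_eqF// sqrtr_gt0.
have ss : s * s = a 0 0 by rewrite -expr2 sqr_sqrtr// ltW.
exists (block_mx s%:M 0 (s^-1 *: r^T) S).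
rewrite tr_block_mx mulmx_block tr_scalar_mx trmx0 !mulmx0 !mul0mx !addr0.
rewrite linearZ /= trmxK -!scalemxAr -!scalemxAl -SE scalerA.
rewrite -invfM ss [X in _ = block_mx _ _ _ X]addrC subrK.
congr block_mx.
- by rewrite -scalar_mxM ss; exact: mx11_scalar.
- by rewrite mul_scalar_mx scalerA mulVf// scale1r.
- by rewrite mul_mx_scalar scalerA mulVf// scale1r.
Qed.

Lemma pos_def_det_gt0 n (M : 'M[R]_n) : M^T = M -> M \in unitmx ->
  pos_def M -> 0 < \det M.
Proof.
move=> MT Mu /(pos_def_gram MT)[S ME].
rewrite lt_def -unitfE -unitmxE Mu /= ME det_mulmx det_tr -expr2.
exact: sqr_ge0.
Qed.

(** Writing [M = S S^T] turns the trace into the squared Frobenius norm of [S^T Y S], and [S] is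
    invertible. *)
Lemma pos_def_trace n (M Y : 'M[R]_n) : M^T = M -> M \in unitmx ->
  pos_def M -> 0 <= \tr (M *m Y *m M *m Y^T) /\
  (\tr (M *m Y *m M *m Y^T) = 0 -> Y = 0).
Proof.
move=> MT Mu /(pos_def_gram MT)[S ME].
have Su : S \in unitmx by move: Mu; rewrite ME unitmx_mul => /andP[].
pose Z := S^T *m Y *m S.
have -> : \tr (M *m Y *m M *m Y^T) = \sum_i \sum_j Z i j ^+ 2.
  have -> : M *m Y *m M *m Y^T = S *m (Z *m S^T *m Y^T).
    by rewrite ME /Z !mulmxA.
  rewrite mxtrace_mulC.
  have -> : Z *m S^T *m Y^T *m S = Z *m Z^T.
    by rewrite /Z !trmx_mul trmxK !mulmxA.
  apply: eq_bigr => i _; rewrite mxE; apply: eq_bigr => j _.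
  by rewrite [Z^T _ _]mxE expr2.
have Z2 i : 0 <= \sum_j Z i j ^+ 2 by apply: sumr_ge0 => j _; exact: sqr_ge0.
split; first exact: sumr_ge0.
move=> /eqP; rewrite psumr_eq0// => /allP Z0.
have {Z0} Z0 : Z = 0.
  apply/matrixP => i j; rewrite [RHS]mxE; apply/eqP; rewrite -sqrf_eq0.
  have := Z0 i (mem_index_enum _) => /implyP/(_ isT).
  rewrite psumr_eq0 => [/allP/(_ j (mem_index_enum _))//|k _].
  exact: sqr_ge0.
have := congr1 (fun A => invmx S^T *m A *m invmx S) Z0.
by rewrite /Z mulmx0 mul0mx -!mulmxA mulmxV// mulmx1 mulKmx// unitmx_tr.
Qed.

(** When [Y l] is the derivative of [g] along the l-th coordinate, the hypothesis says that the
    columns of [h] commute as vector fields. For fixed [i] it makes [h *m P i *m h] symmetric;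
    cancelling [h] on both sides, and then the factors [h i a] inside [P i] by contracting with [g],
    leaves the symmetry of each [Q a]. *)
Lemma curl_free_inverse n (h g : 'M[R]_n) (Y : 'I_n -> 'M[R]_n) :
  h *m g = 1%:M -> h^T = h ->
  (forall i j k, \sum_l h l k * (h *m Y l *m h) i j =
                 \sum_l h l j * (h *m Y l *m h) i k) ->
  forall l a b, Y l a b = Y b a l.
Proof.
move=> hg hT sym.
have gh : g *m h = 1%:M by apply: mulmx1C.
have gT : g^T = g.
  by rewrite -[LHS]mul1mx -gh -mulmxA -{1}hT -trmx_mul gh trmx1 mulmx1.
pose Q a : 'M[R]_n := \matrix_(l, b) Y l a b.
pose P i : 'M[R]_n := \sum_a h i a *: Q a.
have PE i : (P i)^T = P i.
  have E : (h *m (P i *m h))^T = h *m (P i *m h).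
    have Ph l j : (P i *m h) l j = (h *m Y l *m h) i j.
      rewrite mxE [RHS]mxE; apply: eq_bigr => b _; congr (_ * _).
      rewrite mxE summxE; apply: eq_bigr => a _; rewrite !mxE //.
    apply/matrixP => j k; rewrite !mxE.
    under eq_bigr do rewrite Ph -[in h k _]hT mxE.
    under [in RHS]eq_bigr do rewrite Ph -[in h j _]hT mxE.
    exact: sym.
  rewrite !trmx_mul hT in E.
  have := congr1 (fun A => g *m A *m g) E.
  by rewrite !mulmxA gh !mul1mx -!mulmxA hg !mulmx1.
have QE a : (Q a)^T = Q a.
  have -> : Q a = \sum_i g a i *: P i.
    under eq_bigr do rewrite scaler_sumr.
    rewrite exchange_big /=.
    have H c : \sum_i g a i *: (h i c *: Q c) = (a == c)%:R *: Q c.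
      have /matrixP/(_ a c) := gh; rewrite !mxE => <-.
      by rewrite scaler_suml; apply: eq_bigr => i _; rewrite scalerA.
    under eq_bigr do rewrite H.
    rewrite (bigD1 a)//= eqxx scale1r big1 ?addr0// => c /negPf ca.
    by rewrite eq_sym ca scale0r.
  rewrite linear_sum /=; apply: eq_bigr => i _.
  by rewrite linearZ /= PE.
move=> l a b; have /matrixP/(_ b l) := QE a.
by rewrite !mxE.
Qed.

End PositiveDefinite.
(** * Directional derivatives *)

Section DirectionalDerivatives.
Variables (R : realType) (V : normedModType R).
Implicit Types (f : V -> R) (x u v : V).

Lemma derive_sum_fun n (f : 'I_n -> V -> R) x v :
  (forall i, derivable (f i) x v) ->
  'D_v (fun y => \sum_i f i y) x = \sum_i 'D_v (f i) x.
Proof.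
move=> df; rewrite -derive_sum//; congr ('D_v _ x).
by apply/funext => y; rewrite fct_sumE.
Qed.

Lemma derivable_sum_fun n (f : 'I_n -> V -> R) x v :
  (forall i, derivable (f i) x v) -> derivable (fun y => \sum_i f i y) x v.
Proof.
move=> df; rewrite (_ : (fun y => _) = \sum_i f i); last first.
  by apply/funext => y; rewrite fct_sumE.
exact: derivable_sum.
Qed.

Lemma derive_mul f g x v : derivable f x v -> derivable g x v ->
  'D_v (fun y => f y * g y) x = 'D_v f x * g x + f x * 'D_v g x.
Proof.
move=> df dg; transitivity (f x *: 'D_v g x + g x *: 'D_v f x).
  exact: (@deriveM _ _ f g x v df dg).
by move: ('D_v f x) ('D_v g x) => a c; rewrite addrC [g x *: a]mulrC.
Qed.

Lemma differentiable_sum_fun n (f : 'I_n -> V -> R) x :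
  (forall i, differentiable (f i) x) ->
  differentiable (fun y => \sum_i f i y) x.
Proof.
move=> df; rewrite (_ : (fun y => _) = \sum_i f i); last first.
  by apply/funext => y; rewrite fct_sumE.
exact: differentiable_sum.
Qed.

Lemma differentiable_prod n (f : 'I_n -> V -> R) x :
  (forall i, differentiable (f i) x) ->
  differentiable (fun y => \prod_i f i y) x.
Proof.
elim: n f => [|n IH] f df.
  under eq_fun do rewrite big_ord0.
  exact: differentiable_cst.
under eq_fun do rewrite big_ord_recl.
by apply: differentiableM => //; exact: IH.
Qed.

Lemma derive_prod n (f : 'I_n -> V -> R) x v :
  (forall i, differentiable (f i) x) ->
  'D_v (fun y => \prod_i f i y) x =
  \sum_k \prod_i (if i == k then 'D_v (f i) x else f i x).
Proof.
elim: n f => [|n IH] f df.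
  under eq_fun do rewrite big_ord0.
  by rewrite big_ord0 [LHS]derive_cst.
under eq_fun do rewrite big_ord_recl.
have dfd i : derivable (f i) x v by apply: diff_derivable.
rewrite derive_mul//; last by apply/diff_derivable/differentiable_prod.
rewrite IH// big_ord_recl; congr (_ + _).
  by rewrite big_ord_recl eqxx.
rewrite mulr_sumr; apply: eq_bigr => k _.
rewrite big_ord_recl /=; congr (_ * _).
Qed.

Lemma differentiable_det n (M : V -> 'M[R]_n) x :
  (forall i j, differentiable (fun y => M y i j) x) ->
  differentiable (fun y => \det (M y)) x.
Proof.
move=> dM; pose F (s : 'S_n) y := (-1) ^+ s * \prod_i M y i (s i).
have -> : (fun y => \det (M y)) = \sum_s F s.
  by apply/funext => y; rewrite fct_sumE.
elim/big_ind : _ => [|f g|s _]; first exact: differentiable_cst.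
  exact: differentiableD.
apply: differentiableM; first exact: differentiable_cst.
by apply: differentiable_prod => i; exact: dM.
Qed.

Lemma derive_det n (M : V -> 'M[R]_n) x v :
  (forall i j, differentiable (fun y => M y i j) x) ->
  'D_v (fun y => \det (M y)) x =
  \sum_i \sum_j 'D_v (fun y => M y i j) x * cofactor (M x) i j.
Proof.
move=> dM; pose F (s : 'S_n) y := (-1) ^+ s * \prod_i M y i (s i).
have dprod (s : 'S_n) : differentiable (fun y => \prod_i M y i (s i)) x.
  by apply: differentiable_prod => i; exact: dM.
have dF s : derivable (F s) x v.
  apply: diff_derivable; apply: differentiableM; last exact: dprod.
  exact: differentiable_cst.
(* [M x] with row [k] differentiated; its minors along that row are those of [M x]. *)
pose N k : 'M[R]_n := \matrix_(i, j)
  if i == k then 'D_v (fun y => M y i j) x else M x i j.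
have -> : 'D_v (fun y => \det (M y)) x = \sum_s 'D_v (F s) x.
  have -> : (fun y => \det (M y)) = \sum_s F s.
    by apply/funext => y; rewrite fct_sumE.
  suff: is_derive x v (\sum_s F s) (\sum_s 'D_v (F s) x) by case.
  elim/big_ind2 : _ => [|f g h l fg hl|s _]; first exact: is_derive_cst.
    exact: is_deriveD.
  exact/derivableP.
have DF s : 'D_v (F s) x = \sum_k (-1) ^+ s * \prod_i N k i (s i).
  have ds := derivable_cst ((-1) ^+ s : R) x v.
  have dp : derivable (fun y => \prod_i M y i (s i)) x v by exact: diff_derivable.
  rewrite (derive_mul ds dp).
  rewrite derive_cst mul0r add0r derive_prod//.
  rewrite mulr_sumr; apply: eq_bigr => k _; congr (_ * _).
  by apply: eq_bigr => i _; rewrite mxE.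
under eq_bigr do rewrite DF.
rewrite exchange_big /=; apply: eq_bigr => k _.
rewrite -/(\det (N k)) (expand_det_row _ k); apply: eq_bigr => j _.
rewrite mxE eqxx; congr (_ * (_ * \det _)).
by apply/matrixP => a b; rewrite !mxE eq_sym (negPf (neq_lift _ _)).
Qed.

Lemma derive_along_line f x v (t : R) : derivable f (x + t *: v) v ->
  is_derive t 1 (fun s : R => f (x + s *: v)) ('D_v f (x + t *: v)).
Proof.
have E : (fun h : R => h^-1 *: (((fun s : R => f (x + s *: v)) \o shift t) (h *: 1)
      - f (x + t *: v))) =
    (fun h : R => h^-1 *: ((f \o shift (x + t *: v)) (h *: v) - f (x + t *: v))).
  apply/funext => h /=; congr (_ *: (f _ - _)).
  by rewrite [h *: 1]mulr1 scalerDl addrCA.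
by move=> df; split; rewrite /derivable /derive E.
Qed.

Lemma MVT_along_line f x v (t : R) : (forall y, derivable f y v) -> 0 < t ->
  exists2 s, 0 < s < t & f (x + t *: v) - f x = t * 'D_v f (x + s *: v).
Proof.
move=> df t0.
have D (s : R) : is_derive s (1 : R) (fun s : R => f (x + s *: v)) ('D_v f (x + s *: v)).
  exact: derive_along_line.
have cf : {within `[0, t], continuous (fun s : R => f (x + s *: v))}.
  apply: continuous_subspaceT => s.
  by apply: differentiable_continuous; apply/derivable1_diffP; case: (D s).
have [s st E] := MVT t0 (fun s _ => D s) cf.
exists s; first by move: st; rewrite in_itv.
by rewrite scale0r addr0 subr0 mulrC in E.
Qed.

Let translate_quotient f x v a :
  (fun h : R => h^-1 *: (((fun y => f (y + a)) \o shift x) (h *: v) - f (x + a))) =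
  (fun h => h^-1 *: ((f \o shift (x + a)) (h *: v) - f (x + a))).
Proof. by apply/funext => h /=; rewrite addrA. Qed.

Lemma derive_translate f x v a :
  'D_v (fun y => f (y + a)) x = 'D_v f (x + a).
Proof. by rewrite /derive translate_quotient. Qed.

Lemma derivable_translate f x v a :
  derivable f (x + a) v -> derivable (fun y => f (y + a)) x v.
Proof. by rewrite /derivable translate_quotient. Qed.

(** Two applications of the mean value theorem: along [u] to the increment [g] of [f] by [t *: v],
    then along [v] to ['D_u f]. *)
Lemma second_difference_mean f u v x (t : R) :
  (forall y, derivable f y u) -> (forall y, derivable ('D_u f) y v) -> 0 < t ->
  exists r s, [/\ 0 < r < t, 0 < s < t &
    f (x + t *: u + t *: v) - f (x + t *: u) - (f (x + t *: v) - f x) =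
    t ^+ 2 * 'D_v ('D_u f) (x + r *: u + s *: v)].
Proof.
move=> du dv t0; pose g y := f (y + t *: v) - f y.
have dg y : derivable g y u.
  by apply: derivableB => //; exact: derivable_translate.
have [r r0t E] := MVT_along_line x dg t0.
have [s s0t E'] := MVT_along_line (x + r *: u) dv t0.
exists r, s; split=> //; rewrite -[LHS]/(g (x + t *: u) - g x) E expr2 -mulrA.
congr (_ * _); apply: etrans E'; rewrite /g deriveB//; last exact: derivable_translate.
by rewrite derive_translate.
Qed.

Let opprB_exchange (a c d e : R) : a - c - (d - e) = a - d - (c - e).
Proof. by ring. Qed.

(** Schwarz's theorem: the second difference is symmetric in [u] and [v], so the two mixed
    derivatives take a common value at points close to [x], though perhaps not at the same point.
    Values closer than half of the gap to two different limits cannot agree. *)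
Lemma derive_comm f u v x :
  (forall y, derivable f y u) -> (forall y, derivable f y v) ->
  (forall y, derivable ('D_u f) y v) -> (forall y, derivable ('D_v f) y u) ->
  {for x, continuous ('D_v ('D_u f))} -> {for x, continuous ('D_u ('D_v f))} ->
  'D_v ('D_u f) x = 'D_u ('D_v f) x.
Proof.
move=> du dv duv dvu cuv cvu; apply/eqP; rewrite -subr_eq0; apply/negP => /negP ne0.
set A := 'D_v _ x in cuv ne0; set B := 'D_u _ x in cvu ne0.
have e0 : 0 < `|A - B| / 2 by rewrite divr_gt0// normr_gt0.
have /cvgrPdist_lt/(_ _ e0) /nbhs_ballP[d1 /= d10 H1] := cuv.
have /cvgrPdist_lt/(_ _ e0) /nbhs_ballP[d2 /= d20 H2] := cvu.
pose d := Num.min d1 d2; have d0 : 0 < d by rewrite lt_min d10.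
(* [t = d / K] keeps the whole parallelogram within distance [d] of [x]; the summand 1 covers
   [u = v = 0]. *)
pose K := `|u| + `|v| + 1.
have K0 : 0 < K by rewrite ltr_wpDl// addr_ge0.
pose t := d / K; have t0 : 0 < t by rewrite divr_gt0.
have near_x r s : 0 < r < t -> 0 < s < t -> ball x d (x + r *: u + s *: v).
  move=> /andP[r0 rt] /andP[s0 st].
  rewrite -ball_normE /= -addrA opprD addrA subrr sub0r normrN.
  rewrite (le_lt_trans (ler_normD _ _))// !normrZ !gtr0_norm//.
  apply: (@le_lt_trans _ _ (t * (`|u| + `|v|))).
    by rewrite mulrDr lerD// ler_wpM2r// ltW.
  by rewrite /t -mulrA gtr_pMr// mulrC ltr_pdivrMr// mul1r ltrDl.
have [r [s [r0 s0 E]]] := second_difference_mean x du duv t0.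
have [r' [s' [r0' s0' E']]] := second_difference_mean x dv dvu t0.
have {}H1 : `|A - 'D_v ('D_u f) (x + r *: u + s *: v)| < `|A - B| / 2.
  by apply: H1; apply: le_ball (near_x _ _ r0 s0); rewrite ge_min lexx.
have {}H2 : `|B - 'D_u ('D_v f) (x + r' *: v + s' *: u)| < `|A - B| / 2.
  apply: H2; rewrite addrAC.
  by apply: le_ball (near_x _ _ s0' r0'); rewrite ge_min lexx orbT.
have AB (a c : R) : `|A - a| < `|A - B| / 2 -> `|B - c| < `|A - B| / 2 -> a != c.
  move=> Aa Bc; apply/negP => /eqP ac; rewrite -{}ac distrC in Bc.
  have := ltrD Aa Bc; rewrite -splitr => /(le_lt_trans (ler_normD _ _)).
  by rewrite addrA subrK ltxx.
have {AB H1 H2}/eqP := AB _ _ H1 H2; apply.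
have t2 : t ^+ 2 != 0 by rewrite expf_neq0// gt_eqF.
rewrite [x + t *: v + t *: u]addrAC in E'.
apply: (mulfI t2); apply: etrans (esym E) _; apply: etrans E'.
exact: opprB_exchange.
Qed.

End DirectionalDerivatives.
(** * Divergence of periodic vector fields *)

Section PeriodicDivergence.
Variables (R : realType) (n : nat) (M : 'M[R]_n).
Hypothesis Mu : M \in unitmx.
Implicit Types (x : 'rV[R]_n) (f : 'rV[R]_n -> R).

Local Notation lat k := (map_mx intr (k : 'rV[int]_n) *m M).

Definition periodic f := forall (k : 'rV[int]_n) x, f (x + lat k) = f x.

(** The closed parallelepiped spanned by the rows of [M]; subtracting the integer parts of the
    lattice coordinates brings any point into it. *)
Lemma fundamental_cell : exists2 K : set 'rV[R]_n, compact K &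
  forall x, exists k : 'rV[int]_n, K (x + lat k).
Proof.
pose C := [set v : 'rV[R]_n | forall i, `[0, 1]%classic (v ord0 i)].
exists ((fun v => v *m M) @` C).
  apply: continuous_compact; last first.
    apply: (@rV_compact R n (fun=> `[0, 1]%classic)) => i.
    exact: segment_compact.
  apply: continuous_subspaceT.
  under [X in continuous X]eq_fun do rewrite mulmx_sum_row.
  apply: continuous_big => [|i _ v]; first exact: add_continuous.
  by apply: continuousZr_tmp; exact: coord_continuous.
move=> x; pose c := x *m invmx M.
exists (\row_i - Num.floor (c 0 i)).
exists (\row_i (c 0 i - (Num.floor (c 0 i))%:~R)).
  move=> i /=; rewrite mxE in_itv /= subr_ge0 floor_le /=.
  by rewrite lerBlDr addrC -[1]/(1%:~R) -intrD ltW// floorD1_gt.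
rewrite -[x in RHS](mulmxKV Mu) -/c -mulmxDl; congr (_ *m _).
by apply/rowP => i; rewrite !mxE mulrNz.
Qed.

(** A step in direction [r] adds [delta_mx 0 r] in the cyclic group of grid indices, hence permutes
    the grid up to lattice vectors. The size [N.+2] gives the index type its ring structure, with a
    1 for [delta_mx]. *)
Lemma telescope_periodic (N : nat) f (r : 'I_n) x : periodic f ->
  \sum_(k : 'rV['I_N.+2]_n)
     (f (x + N.+2%:R^-1 *: (map_mx (fun a : 'I_N.+2 => (a : nat)%:R) k *m M)
          + N.+2%:R^-1 *: row r M) -
      f (x + N.+2%:R^-1 *: (map_mx (fun a : 'I_N.+2 => (a : nat)%:R) k *m M))) = 0.
Proof.
move=> pf; rewrite sumrB; apply/eqP; rewrite subr_eq0; apply/eqP.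
rewrite [RHS](reindex_inj (@addIr _ (delta_mx 0 r : 'rV['I_N.+2]_n))) /=.
apply: eq_bigr => k _.
(* The carry: 1 in coordinate [r] if the index there wraps around from [N.+1] to 0, and 0
   otherwise. *)
pose q : 'rV[int]_n := \row_s (((k ord0 s + (s == r)) %/ N.+2)%N : int).
rewrite -(pf q (x + N.+2%:R^-1 *: (map_mx _ (_ + _) *m M))); congr f.
rewrite rowE -!addrA; congr (_ + _).
rewrite -scalerDr -mulmxDl !scalemxAl -mulmxDl; congr (_ *m _).
apply/rowP => s; rewrite !mxE /=.
have N0 : (N.+2%:R : R) != 0 by rewrite pnatr_eq0.
apply: (mulfI N0); rewrite [RHS]mulrDr !mulVKf//.
have -> : ((((k ord0 s + (s == r)) %/ N.+2)%N : int)%:~R : R) =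
    ((k ord0 s + (s == r)) %/ N.+2)%N%:R by [].
rewrite -natrM -natrD -natrD; congr (_%:R).
rewrite [LHS](divn_eq _ N.+2) mulnC addnC; congr (_ + _)%N.
by case: (s == r) => /=; rewrite ?modnDmr ?addn0.
Qed.

(* Summed over the grid of mesh 1/N in the lattice directions, the increments
   of each W r telescope to 0; by compactness they all have a positive sum once
   N is large. *)
Lemma divergence_not_pos (W : 'I_n -> 'rV[R]_n -> R) :
  (forall r, periodic (W r)) ->
  (forall r x, derivable (W r) x (row r M)) ->
  (forall r, continuous ('D_(row r M) (W r))) ->
  ~ (forall x, 0 < \sum_r 'D_(row r M) (W r) x).
Proof.
move=> pW dW cW pos.
have [K Kc Kx] := fundamental_cell.
pose P (h : R) x := 0 < \sum_r (W r (x + h *: row r M) - W r x).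
have : \forall h \near 0^'+, K `<=` P h.
  move/compact_near_coveringP : Kc; apply => x0 _.
  (* Lowering each of the [n] derivatives by [e] still leaves the fraction [1 / n.+1] of their
     positive sum. *)
  pose e := (\sum_r 'D_(row r M) (W r) x0) / n.+1%:R.
  have e0 : 0 < e by rewrite divr_gt0// ltr0n.
  have H r : \forall x \near x0 & h \near 0^'+,
      h * ('D_(row r M) (W r) x0 - e) <= W r (x + h *: row r M) - W r x.
    have : \forall x \near x0 & s \near (0 : R), 'D_(row r M) (W r) x0 - e <
        'D_(row r M) (W r) (x + s *: row r M).
      have : {for (x0, 0 : R), continuous (fun z : 'rV[R]_n * R =>
          'D_(row r M) (W r) (z.1 + z.2 *: row r M))}.
        apply: (@continuous_comp _ _ _ (fun z : 'rV[R]_n * R => z.1 + z.2 *: row r M)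
          ('D_(row r M) (W r)) (x0, 0)).
          apply: continuousD; first exact: cvg_fst.
          by apply: continuousZr_tmp; exact: cvg_snd.
        exact: cW.
      move/cvgrPdist_lt => /(_ _ e0); rewrite /= scale0r addr0; apply: filterS => z /=.
      by rewrite ltr_norml => /andP[_]; rewrite ltrBlDr ltrBlDl addrC.
    case=> -[U S] /= [Ux0 /nbhs_ballP[d /= d0 dS]] US.
    exists (U, [set h | 0 < h < d]) => /=.
      split=> //; near=> h; apply/andP; split; near: h.
        exact: nbhs_right_gt.
      exact: nbhs_right_lt.
    move=> [x h] /= [Ux /andP[h0 hd]].
    have [s /andP[s0 sh] ->] := MVT_along_line x (dW r) h0.
    rewrite ler_pM2l// ltW//; apply: (US (x, s)); split=> //=.
    by apply: dS; rewrite -ball_normE /= sub0r normrN gtr0_norm// (lt_trans sh).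
  have hpos : \forall x \near x0 & h \near 0^'+, (0 : R) < h.
    exists (setT, [set h : R | 0 < h]) => [/=|[x h] []//].
    by split; [exact: filterT|exact: nbhs_right_gt].
  have Hall : \forall x \near x0 & h \near 0^'+, forall r,
      h * ('D_(row r M) (W r) x0 - e) <= W r (x + h *: row r M) - W r x.
    pose Q r : set ('rV[R]_n * R) := [set z |
      z.2 * ('D_(row r M) (W r) x0 - e) <= W r (z.1 + z.2 *: row r M) - W r z.1].
    exact: (@filter_forall _ _ Q (filter_prod (nbhs x0) (at_right (0 : R))) _ H).
  move: hpos Hall; apply: filterS2 => -[x h] /= h0 Hr.
  rewrite /P; apply: (@lt_le_trans _ _ (\sum_r h * ('D_(row r M) (W r) x0 - e))).
    rewrite -mulr_sumr mulr_gt0// sumrB sumr_const card_ord subr_gt0.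
    rewrite /e -[X in X < _]mulr_natr -mulrA gtr_pMr//.
    by rewrite mulrC ltr_pdivrMr ?ltr0n// mul1r ltr_nat.
  by apply: ler_sum => r _; exact: Hr.
case=> e /= e0 He.
have [N _ /(_ _ (leqnSn N)) Ne] : \forall N \near \oo, (N.+1%:R : R)^-1 < e.
  exact: (near_infty_natSinv_lt (PosNum e0)).
(* Positivity is known on [K] only; periodicity spreads it to every point. *)
have PN x : P N.+2%:R^-1 x.
  have [k Kk] := Kx x.
  have := He N.+2%:R^-1; rewrite /= sub0r normrN ger0_norm ?invr_ge0//.
  move=> /(_ Ne); rewrite invr_gt0 ltr0n => /(_ isT) /(_ _ Kk).
  congr (0 < _); apply: eq_bigr => r _.
  by rewrite pW addrAC pW.
pose p (k : 'rV['I_N.+2]_n) : 'rV[R]_n :=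
   N.+2%:R^-1 *: (map_mx (fun a : 'I_N.+2 => (a : nat)%:R) k *m M).
have : 0 < \sum_(k : 'rV['I_N.+2]_n)
    \sum_r (W r (0 + p k + N.+2%:R^-1 *: row r M) - W r (0 + p k)).
  rewrite (bigD1 0)//= ltr_wpDr//; last exact: PN.
  by apply: sumr_ge0 => k _; apply/ltW/PN.
rewrite exchange_big big1 ?ltxx// => r _.
exact: telescope_periodic.
Unshelve. all: by end_near. Qed.

Let continuous_translate f t : continuous f -> continuous (fun x => f (x + t)).
Proof.
move=> cf x; apply: (@continuous_comp _ _ _ (fun y : 'rV[R]_n => y + t) f x).
  by apply: continuousD; [exact: cvg_id|exact: cst_continuous].
exact: cf.
Qed.

(* If the divergence is positive somewhere, finitely many of its translates have
   an everywhere positive sum. *)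
Lemma divergence_eq0 (W : 'I_n -> 'rV[R]_n -> R) :
  (forall r, periodic (W r)) ->
  (forall r x, derivable (W r) x (row r M)) ->
  (forall r, continuous ('D_(row r M) (W r))) ->
  (forall x, 0 <= \sum_r 'D_(row r M) (W r) x) ->
  forall x, \sum_r 'D_(row r M) (W r) x = 0.
Proof.
move=> pW dW cW; pose F x : R := \sum_r 'D_(row r M) (W r) x.
rewrite -[forall x, 0 <= _]/(forall x, 0 <= F x) => F0 x0; rewrite -/(F x0).
apply/eqP; rewrite eq_le F0 andbT leNgt; apply/negP => Fx0.
have pF : periodic F.
  move=> k x; apply: eq_bigr => r _; rewrite -derive_translate.
  by under [X in derive X]funext do rewrite pW.
have cF : continuous F.
  by apply: continuous_big => [|r _]; [exact: add_continuous|exact: cW].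
have [K Kc Kx] := fundamental_cell.
move: Kc; rewrite compact_cover.
(* The sets where a translate of [F] is positive are open, and they cover everything because every
   point can be moved to [x0]. *)
move=> /(_ 'rV[R]_n setT (fun t => [set x | 0 < F (x + t)]))[].
- move=> t _; rewrite openE => x /= Fx.
  exact: (cvgr_gt _ (@continuous_translate F t cF x) _ Fx).
- by move=> x _; exists (x0 - x) => //=; rewrite addrC subrK.
move=> D _ KD; pose s := finmap.enum_fset D.
pose W' r x := \sum_(i < size s) W r (x + s`_i).
have DW' r x : 'D_(row r M) (W' r) x = \sum_(i < size s) 'D_(row r M) (W r) (x + s`_i).
  rewrite derive_sum_fun; last by move=> i; exact: derivable_translate.
  by apply: eq_bigr => i _; rewrite derive_translate.
apply: (@divergence_not_pos W').
- by move=> r k x; apply: eq_bigr => i _; rewrite addrAC pW.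
- by move=> r x; apply: derivable_sum_fun => i; exact: derivable_translate.
- move=> r; rewrite (_ : 'D__ _ =
    fun x => \sum_(i < size s) 'D_(row r M) (W r) (x + s`_i)); last first.
    exact/funext/DW'.
  apply: continuous_big => [|i _ x]; first exact: add_continuous.
  exact: (@continuous_translate _ _ (cW r)).
- move=> x; under eq_bigr do rewrite DW'.
  rewrite exchange_big /=.
  have [k /KD[t tD /= Ft]] := Kx x.
  rewrite addrAC pF in Ft.
  have ts : (index t s < size s)%N by rewrite index_mem.
  rewrite (bigD1 (Ordinal ts))//= nth_index//.
  apply: ltr_pwDl; first exact: Ft.
  by apply: sumr_ge0 => i _; exact: F0.
Qed.

End PeriodicDivergence.
(** * Derivatives of inverses and determinants *)

Section MatrixDerivative.
Variables (R : realType) (V : normedModType R) (n : nat).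
Implicit Types (g : V -> 'M[R]_n) (x v : V).

Definition derive_entries v g x : 'M[R]_n :=
  \matrix_(i, j) 'D_v (fun y => g y i j) x.

Lemma invmxE (A : 'M[R]_n) i j : A \in unitmx ->
  invmx A i j = (\det A)^-1 * \adj A i j.
Proof. by move=> Au; rewrite /invmx Au mxE. Qed.

Lemma differentiable_adjugate g x i j : g x \in unitmx ->
  (forall i j, differentiable (fun y => g y i j) x) ->
  differentiable (fun y => (\det (g y))^-1 * \adj (g y) i j) x.
Proof.
move=> gu dg; apply: differentiableM.
  apply: differentiableV; first exact: differentiable_det.
  by rewrite -unitfE.
under eq_fun do rewrite mxE.
apply: differentiableM; first exact: differentiable_cst.
apply: differentiable_det => k l.
by under eq_fun do rewrite !mxE; exact: dg.
Qed.

Lemma derivable_invmx g x v i j : (\near x, g x \in unitmx) ->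
  (forall i j, differentiable (fun y => g y i j) x) ->
  derivable (fun y => invmx (g y) i j) x v.
Proof.
move=> gu dg.
apply: (@near_eq_derivable _ _ _ (fun y => (\det (g y))^-1 * \adj (g y) i j)).
  by near=> y; rewrite invmxE//; near: y.
apply: diff_derivable; apply: differentiable_adjugate => //.
exact: nbhs_singleton gu.
Unshelve. all: by end_near. Qed.

Lemma differentiable_invmx g x i j : (forall y, g y \in unitmx) ->
  (forall i j, differentiable (fun y => g y i j) x) ->
  differentiable (fun y => invmx (g y) i j) x.
Proof.
move=> gu dg; under eq_fun do rewrite invmxE//.
exact: differentiable_adjugate.
Qed.

(** Obtained by differentiating [invmx (g y) *m g y = 1%:M], which holds near [x]. *)
Lemma derive_invmx g x v i j : (\near x, g x \in unitmx) ->
  (forall i j, differentiable (fun y => g y i j) x) ->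
  'D_v (fun y => invmx (g y) i j) x =
  - (invmx (g x) *m derive_entries v g x *m invmx (g x)) i j.
Proof.
move=> gu dg; have gxu := nbhs_singleton gu.
pose h y := invmx (g y).
have dgv k l : derivable (fun y => g y k l) x v by exact: diff_derivable.
have dh k l : derivable (fun y => h y k l) x v by exact: derivable_invmx.
suff : derive_entries v h x *m g x + h x *m derive_entries v g x = 0.
  move=> /(congr1 (fun A => A *m h x)).
  rewrite mulmxDl mul0mx -(mulmxA _ (g x)) (mulmxV gxu) mulmx1.
  move=> /eqP; rewrite addr_eq0 => /eqP/matrixP/(_ i j).
  by rewrite !mxE.
apply/matrixP => k l; rewrite !mxE -big_split /=.
under eq_bigr do rewrite [X in X * _ + _]mxE [X in _ + _ * X]mxE -derive_mul//.
rewrite -derive_sum_fun; last by move=> m; exact: derivableM.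
rewrite (@near_eq_derive R V R _ (cst ((k == l)%:R))) ?derive_cst//.
near=> y; have yu : g y \in unitmx by near: y.
by have /matrixP/(_ k l) := mulVmx yu; rewrite !mxE.
Unshelve. all: by end_near. Qed.

Lemma derive_det_unit g x v : g x \in unitmx ->
  (forall i j, differentiable (fun y => g y i j) x) ->
  'D_v (fun y => \det (g y)) x =
  \det (g x) * \tr (invmx (g x) *m derive_entries v g x).
Proof.
move=> gu dg; rewrite derive_det// -mxtraceZ scalemxAl /mxtrace.
rewrite exchange_big /=; apply: eq_bigr => j _; rewrite mxE; apply: eq_bigr => i _.
rewrite [RHS]mulrC 2!mxE invmxE// mulVKf -?unitfE -?unitmxE//.
by rewrite [\adj _ _ _]mxE.
Qed.

Lemma differentiable_sqrt_det g x : 0 < \det (g x) ->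
  (forall i j, differentiable (fun y => g y i j) x) ->
  differentiable (fun y => Num.sqrt (\det (g y))) x.
Proof.
move=> d0 dg; apply: (@differentiable_comp _ _ _ _ (fun y => \det (g y)) Num.sqrt).
  exact: differentiable_det.
by apply/derivable1_diffP; have [] := is_derive1_sqrt d0.
Qed.

(** Differentiate the square [s y * s y = \det (g y)], valid near [x], and cancel [s x > 0]. *)
Lemma derive_sqrt_det g x v : 0 < \det (g x) ->
  (forall i j, differentiable (fun y => g y i j) x) ->
  'D_v (fun y => Num.sqrt (\det (g y))) x =
  Num.sqrt (\det (g x)) * \tr (invmx (g x) *m derive_entries v g x) / 2.
Proof.
move=> d0 dg; pose s y := Num.sqrt (\det (g y)).
have ds : derivable s x v by apply/diff_derivable/differentiable_sqrt_det.
have gu : g x \in unitmx by rewrite unitmxE unitfE gt_eqF.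
have s0 : 0 < s x by rewrite sqrtr_gt0.
have : 'D_v (fun y => s y * s y) x = 'D_v (fun y => \det (g y)) x.
  apply: near_eq_derive.
  have : \forall y \near x, 0 < \det (g y).
    have /differentiable_continuous c := differentiable_det dg.
    exact: (cvgr_gt _ c _ d0).
  by apply: filterS => y y0; rewrite -expr2 sqr_sqrtr// ltW.
rewrite derive_mul// derive_det_unit// -/s -/(s x).
have -> : \det (g x) = s x ^+ 2 by rewrite sqr_sqrtr// ltW.
rewrite expr2; set T := \tr _ => E.
apply: (mulfI (lt0r_neq0 s0)).
have -> : s x * 'D_v s x = (s x * s x * T) / 2 by rewrite -E; field.
by rewrite !mulrA.
Qed.

End MatrixDerivative.

Lemma derive_basis (R : realType) n (f : 'rV[R]_n -> R) x v :
  differentiable f x ->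
  'D_v f x = \sum_s v 0 s * 'D_(delta_mx 0 s) f x.
Proof.
move=> df; rewrite deriveE// {1}[v]row_sum_delta linear_sum /=.
by apply: eq_bigr => s _; rewrite linearZ /= deriveE.
Qed.

(** For [h] inverse to [g] and [Y] the derivatives of [g], the left side is minus the divergence of
    column [j] of [h]; total symmetry lets the contraction of [Y] with [h] be read as a trace. *)
Lemma curl_free_divergence (R : comNzRingType) n (h : 'M[R]_n) (Y : 'I_n -> 'M[R]_n) j :
  (forall l a b, Y l a b = Y b a l) ->
  \sum_k (h *m Y k *m h) k j = \sum_b \tr (h *m Y b) * h b j.
Proof.
move=> curl; under eq_bigr do rewrite mxE.
rewrite exchange_big /=; apply: eq_bigr => b _; rewrite -mulr_suml.
congr (_ * _); apply: eq_bigr => k _; rewrite !mxE.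
by apply: eq_bigr => a _; rewrite curl.
Qed.
(** * Periodic metrics on a fibre *)

Section Fibre.
Variables (R : realType) (n : nat) (g : 'rV[R]_n -> 'M[R]_n).
Implicit Types (x v w : 'rV[R]_n).
Hypothesis g_smooth : forall i j, smooth_on setT (fun x => g x i j).
Hypothesis g_unit : forall x, g x \in unitmx.
Hypothesis g_sym : forall x, (g x)^T = g x.
Hypothesis ginv_pos : forall x, pos_def (invmx (g x)).

Local Notation h x := (invmx (g x)).
Local Notation e s := (delta_mx 0 s : 'rV[R]_n).
Local Notation Y s x := (derive_entries (e s) g x).
Local Notation gc i j := (fun z => g z i j).
Local Notation hc i j := (fun z => invmx (g z) i j).

Hypothesis curl : forall x l a b, Y l x a b = Y b x a l.
Hypothesis trace0 : forall x s, \tr (h x *m Y s x) = 0.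

Let dg i j x : differentiable (gc i j) x.
Proof. exact: (g_smooth i j [::]). Qed.

Let d2g i j v x : differentiable ('D_v (gc i j)) x.
Proof. exact: (g_smooth i j [:: v]). Qed.

Let d3g i j v w x : differentiable ('D_w ('D_v (gc i j))) x.
Proof. exact: (g_smooth i j [:: v; w]). Qed.

Let gnear x : \near x, g x \in unitmx.
Proof. by apply: filterE. Qed.

Let dgx x i j : differentiable (gc i j) x.
Proof. exact: dg. Qed.

Let dh i j x : differentiable (hc i j) x.
Proof. by apply: differentiable_invmx => // k l; exact: dg. Qed.

Let DhE v i j : 'D_v (hc i j) =
  fun x => - \sum_b (\sum_a h x i a * 'D_v (gc a b) x) * h x b j.
Proof.
apply/funext => x; rewrite (derive_invmx v i j (gnear x) (dgx x)).
rewrite mxE; congr (- _); apply: eq_bigr => b _; congr (_ * _).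
by rewrite mxE; apply: eq_bigr => a _; rewrite mxE.
Qed.

Let d2h i j v x : differentiable ('D_v (hc i j)) x.
Proof.
rewrite DhE; apply: differentiableN; apply: differentiable_sum_fun => b.
apply: differentiableM => //; apply: differentiable_sum_fun => a.
exact: differentiableM.
Qed.

Let schwarz i j v w x :
  'D_w ('D_v (gc i j)) x = 'D_v ('D_w (gc i j)) x.
Proof.
apply: derive_comm => [y|y|y|y||]; try exact: diff_derivable.
  exact: differentiable_continuous.
exact: differentiable_continuous.
Qed.

Variable c : 'I_n.

Let W a x := \sum_b h x a b * 'D_(e b) (gc c c) x.

Let dW a x : differentiable (W a) x.
Proof. by apply: differentiable_sum_fun => b; exact: differentiableM. Qed.

Let DWE a v x : 'D_v (W a) x =
  \sum_b ('D_v (hc a b) x * 'D_(e b) (gc c c) x +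
          h x a b * 'D_v ('D_(e b) (gc c c)) x).
Proof.
rewrite derive_sum_fun => [|b].
  by apply: eq_bigr => b _; rewrite derive_mul//; exact: diff_derivable.
by apply/diff_derivable/differentiableM.
Qed.

Let d2W a v x : differentiable ('D_v (W a)) x.
Proof.
rewrite (funext (DWE a v)); apply: differentiable_sum_fun => b.
by apply: differentiableD; apply: differentiableM.
Qed.

(** This is the divergence equation with the constant factor [V] removed; it kills the term of the
    divergence of [W] in which [h] is differentiated. *)
Let inverse_divergence_free b x : \sum_a 'D_(e a) (hc a b) x = 0.
Proof.
under eq_bigr do rewrite (derive_invmx _ _ _ (gnear x) (dgx x)).
rewrite sumrN (curl_free_divergence _ _ (curl x)) big1 ?oppr0// => s _.
by rewrite trace0 mul0r.
Qed.

(* Differentiating tr (h (D_c g)) = 0 once more in the direction c turns the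
   divergence of h grad g_cc into a term without second derivatives. *)
Let divW x : \sum_a 'D_(e a) (W a) x = \tr (h x *m Y c x *m h x *m (Y c x)^T).
Proof.
have gs a b : gc a b = gc b a.
  by apply/funext => z; rewrite -{1}g_sym mxE.
have curlf l a b : 'D_(e l) (gc a b) = 'D_(e b) (gc a l).
  by apply/funext => z; have := curl z l a b; rewrite !mxE.
(* By [curlf] and Schwarz the second derivatives of [g] are symmetric in all four indices. *)
have D2 a b : 'D_(e a) ('D_(e b) (gc c c)) x = 'D_(e c) ('D_(e c) (gc a b)) x.
  by rewrite curlf schwarz (gs c b) curlf (gs b a).
have tr0 : \sum_a \sum_b ('D_(e c) (hc a b) x * 'D_(e c) (gc a b) x +
    h x a b * 'D_(e c) ('D_(e c) (gc a b)) x) = 0.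
  transitivity ('D_(e c) (fun z => \sum_a \sum_b h z a b * 'D_(e c) (gc a b) z) x).
    rewrite derive_sum_fun => [|a].
      apply: eq_bigr => a _; rewrite derive_sum_fun => [|b].
        by apply: eq_bigr => b _; rewrite derive_mul//; exact: diff_derivable.
      by apply/diff_derivable/differentiableM.
    apply/diff_derivable/differentiable_sum_fun => b.
    exact: differentiableM.
  rewrite (_ : (fun z => _) = cst 0) ?derive_cst//.
  apply/funext => z; rewrite -[RHS](trace0 z c); apply: eq_bigr => a _.
  by rewrite mxE; apply: eq_bigr => b _; rewrite mxE gs.
transitivity (\sum_a \sum_b 'D_(e a) (hc a b) x * 'D_(e b) (gc c c) x +
   \sum_a \sum_b h x a b * 'D_(e c) ('D_(e c) (gc a b)) x).
  rewrite -big_split /=; apply: eq_bigr => a _; rewrite DWE -big_split /=.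
  by apply: eq_bigr => b _; rewrite D2.
rewrite exchange_big /= [X in X + _]big1 => [|b _]; last first.
  by rewrite -mulr_suml inverse_divergence_free mul0r.
have {}tr0 : \sum_a \sum_b 'D_(e c) (hc a b) x * 'D_(e c) (gc a b) x +
    \sum_a \sum_b h x a b * 'D_(e c) ('D_(e c) (gc a b)) x = 0.
  rewrite -[RHS]tr0 -big_split /=; apply: eq_bigr => a _.
  by rewrite -big_split.
move/eqP: tr0; rewrite addrC addr_eq0 add0r => /eqP ->.
rewrite -sumrN; apply: eq_bigr => a _; rewrite mxE -sumrN; apply: eq_bigr => b _.
by rewrite (derive_invmx _ _ _ (gnear x) (dgx x)) mulNr opprK !mxE.
Qed.

Variable M : 'M[R]_n.
Hypothesis Mu : M \in unitmx.
Hypothesis g_periodic : forall i j, periodic M (gc i j).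

Lemma derive_entry_eq0 x : Y c x = 0.
Proof.
have g_per (k : 'rV[int]_n) z : g (z + map_mx intr k *m M) = g z.
  by apply/matrixP => i j; exact: g_periodic.
(* The components of [W] in the basis of rows of [M], since [divergence_eq0] differentiates along
   these rows; the divergence is unchanged. *)
pose U r x := \sum_a invmx M a r * W a x.
have dU r z : differentiable (U r) z.
  by apply: differentiable_sum_fun => a; apply: differentiableM.
have DU r v z : 'D_v (U r) z = \sum_a invmx M a r * 'D_v (W a) z.
  rewrite derive_sum_fun => [|a].
    apply: eq_bigr => a _.
    rewrite derive_mul ?derive_cst ?mul0r ?add0r//; exact: diff_derivable.
  by apply/diff_derivable/differentiableM.
have divU z : \sum_r 'D_(row r M) (U r) z = \sum_a 'D_(e a) (W a) z.
  under eq_bigr do rewrite DU.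
  rewrite exchange_big /=; apply: eq_bigr => a _.
  under eq_bigr do rewrite derive_basis// mulr_sumr.
  rewrite exchange_big /=.
  transitivity (\sum_s (a == s)%:R * 'D_(e s) (W a) z).
    apply: eq_bigr => s _; have /matrixP/(_ a s) := mulVmx Mu.
    rewrite !mxE => <-; rewrite mulr_suml; apply: eq_bigr => r _.
    by rewrite mulrA mxE.
  rewrite (bigD1 a)//= eqxx mul1r big1 ?addr0// => s /negPf sa.
  by rewrite eq_sym sa mul0r.
have hT z : (h z)^T = h z by rewrite trmx_inv g_sym.
have hu z : h z \in unitmx by rewrite unitmx_inv.
have pos z := pos_def_trace (Y c z) (hT z) (hu z) (@ginv_pos z).
have : \sum_r 'D_(row r M) (U r) x = 0.
  apply: (@divergence_eq0 _ _ _ Mu U) => [r k z|r z|r z|z].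
  - apply: eq_bigr => a _; congr (_ * _); apply: eq_bigr => b _.
    rewrite g_per -derive_translate.
    by under [X in derive X]funext do rewrite g_per.
  - exact: diff_derivable.
  - apply: differentiable_continuous; rewrite (_ : 'D__ _ =
      fun z => \sum_a invmx M a r * 'D_(row r M) (W a) z); last first.
      exact/funext/DU.
    by apply: differentiable_sum_fun => a; apply: differentiableM.
  - by rewrite divU divW; case: (pos z).
by rewrite divU divW; case: (pos x).
Qed.

End Fibre.

Lemma fibre_metric_const (R : realType) n (M : 'M[R]_n) (g : 'rV[R]_n -> 'M[R]_n) :
  M \in unitmx ->
  (forall i j, periodic M (fun x => g x i j)) ->
  (forall i j, smooth_on setT (fun x => g x i j)) ->
  (forall x, g x \in unitmx) -> (forall x, (g x)^T = g x) ->
  (forall x, pos_def (invmx (g x))) ->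
  (forall x (l a b : 'I_n), derive_entries (delta_mx 0 l) g x a b =
                            derive_entries (delta_mx 0 b) g x a l) ->
  (forall x (s : 'I_n), \tr (invmx (g x) *m derive_entries (delta_mx 0 s) g x) = 0) ->
  forall x, g x = g 0.
Proof.
move=> Mu pg gs gu gT gp curl tr0 x; apply/matrixP => i j.
have D z : 'D_x (fun y => g y i j) z = 0.
  rewrite derive_basis; last exact: (gs i j [::]).
  apply: big1 => s _.
  have /matrixP/(_ i j) := derive_entry_eq0 gs gu gT gp curl tr0 s Mu pg z.
  by rewrite !mxE => ->; rewrite mulr0.
have dx z : derivable (fun y => g y i j) z x.
  by apply: diff_derivable; exact: (gs i j [::]).
have [s _] := MVT_along_line 0 dx ltr01.
by rewrite D mulr0 scale1r add0r => /eqP; rewrite subr_eq0 => /eqP.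
Qed.
(** * Consequences of the closedness of the holomorphic volume form *)

(** Expansion along the unit row on top. It recasts each summand of [extd] as a bordered
    determinant, with the sign absorbed. *)
Lemma signed_minor (R : comNzRingType) n (T : 'M[R]_(n, n.+1)) (i : 'I_n.+1) :
  (-1) ^+ i * \det (\matrix_(r, j) T r (lift i j)) =
  \det (col_mx (delta_mx 0 i : 'rV[R]_n.+1) T : 'M[R]_(1 + n)).
Proof.
have l0 : (0 : 'I_(1 + n)) = lshift n 0 by exact: val_inj.
set A := col_mx _ _.
have A0 j : A 0 j = (j == i)%:R by rewrite /A l0 (@col_mxEu _ 1 n) mxE eqxx.
rewrite (expand_det_row _ 0) (bigD1 i)//= big1 ?addr0 => [|j /negPf ji]; last first.
  by rewrite A0 ji mul0r.
rewrite A0 eqxx mul1r /cofactor add0n; congr (_ * \det _).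
apply/matrixP => r j; rewrite !mxE.
have -> : lift (0 : 'I_(1 + n)) r = rshift 1 r by exact: val_inj.
by rewrite (unsplitK (inr r)).
Qed.

Section HolomorphicVolume.
Variables (R : realType) (n : nat).
Local Notation E := (('rV[R]_n * 'rV[R]_n)%type).
Implicit Types (b g : E -> 'M[R]_n) (p q : E).

Definition fibre_dir (k : 'I_n) : E := (delta_mx 0 k, 0).
Definition base_dir (k : 'I_n) : E := (0, delta_mx 0 k).

Lemma theta_fibre b g i p k : theta b g i p (fibre_dir k) = (i == k)%:R.
Proof.
rewrite /theta /= big1 => [|j _]; last first.
  by rewrite [X in X%:C%C]mxE mulr0.
by rewrite mxE eqxx addr0 eq_sym; case: (k == i).
Qed.

Lemma theta_base b g i p k : theta b g i p (base_dir k) = beta b g p i k.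
Proof.
rewrite /theta /= mxE add0r (bigD1 k)//= big1 => [|j /negPf jk]; last first.
  by rewrite [X in X%:C%C]mxE jk andbF mulr0.
by rewrite [X in X%:C%C]mxE !eqxx mulr1 addr0.
Qed.

Lemma Omega_minor b g p (v : 'I_n.+1 -> E) (i : 'I_n.+1) :
  (-1) ^+ i * Omega b g p (fun j => v (lift i j)) =
  (Num.sqrt (\det (g p)))%:C%C *
  \det (col_mx (delta_mx 0 i : 'rV[R[i]]_n.+1)
    (\matrix_(r, j) theta b g r p (v j)) : 'M[R[i]]_(1 + n)).
Proof.
rewrite /Omega /wedge mulrCA -signed_minor; congr (_ * (_ * \det _)).
by apply/matrixP => r j; rewrite !mxE.
Qed.

(* The frames (d/dy_k, d/dx_1, ..., d/dx_n) and, with d/dx_l replaced by d/dy_j,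
   (d/dy_k, ..., d/dy_j, ...); d Omega = 0 on them gives the divergence equations
   and the integrability of the complex structure. *)
Definition frame1 (k : 'I_n) (i : 'I_(1 + n)) : E :=
  match fintype.split i with inl _ => base_dir k | inr m => fibre_dir m end.

Definition frame2 (k j l : 'I_n) (i : 'I_(1 + n)) : E :=
  match fintype.split i with
  | inl _ => base_dir k
  | inr m => if m == l then base_dir j else fibre_dir m
  end.

Lemma frame1_base k : frame1 k (lshift n 0) = base_dir k.
Proof. by rewrite /frame1 (unsplitK (inl 0)). Qed.

Lemma frame1_fibre k m : frame1 k (rshift 1 m) = fibre_dir m.
Proof. by rewrite /frame1 (unsplitK (inr m)). Qed.

Lemma frame2_base k j l : frame2 k j l (lshift n 0) = base_dir k.
Proof. by rewrite /frame2 (unsplitK (inl 0)). Qed.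

Lemma frame2_fibre k j l m :
  frame2 k j l (rshift 1 m) = if m == l then base_dir j else fibre_dir m.
Proof. by rewrite /frame2 (unsplitK (inr m)). Qed.

Let frame1_mx b g p k : \matrix_(r, j) theta b g r p (frame1 k j) =
  row_mx (col k (beta b g p)) 1%:M :> 'M[R[i]]_(n, 1 + n).
Proof.
apply/matrixP => r j; rewrite !mxE /frame1; case: fintype.split => m.
  by rewrite theta_base [RHS]mxE.
by rewrite theta_fibre [RHS]mxE.
Qed.

Let frame2_mx b g p k j l : \matrix_(r, i) theta b g r p (frame2 k j l i) =
  row_mx (col k (beta b g p))
    (1%:M + (col j (beta b g p) - delta_mx l 0) *m delta_mx 0 l) :> 'M[R[i]]_(n, 1 + n).
Proof.
apply/matrixP => r i; rewrite !mxE /frame2; case: fintype.split => m.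
  by rewrite theta_base [RHS]mxE.
rewrite !mxE big_ord1 !mxE !eqxx andbT /=.
have [-> | /negPf ml] := eqVneq m l.
  by rewrite theta_base mulr1 [RHS]addrC subrK mxE.
by rewrite theta_fibre mulr0 addr0.
Qed.

Let det_split (a0 : R[i]) (a : 'rV[R[i]]_n) (c : 'cV[R[i]]_n) (D : 'M[R[i]]_n) :
  \det (col_mx (row_mx a0%:M a) (row_mx c D) : 'M[R[i]]_(1 + n)) =
  \det (block_mx a0%:M a c D).
Proof. by []. Qed.

Let delta_lshift : delta_mx 0 (lshift n 0) = row_mx 1%:M 0 :> 'rV[R[i]]_(1 + n).
Proof.
apply/rowP => j; rewrite !mxE eqxx; case: split_ordP => m ->.
  by rewrite !mxE !ord1 !eqxx.
by rewrite !mxE eq_rlshift.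
Qed.

Let delta_rshift (m : 'I_n) :
  delta_mx 0 (rshift 1 m) = row_mx (0%:M : 'M[R[i]]_1) (delta_mx 0 m) :> 'rV[R[i]]_(1 + n).
Proof.
apply/rowP => j; rewrite !mxE eqxx; case: split_ordP => l ->.
  by rewrite !mxE eq_lrshift mul0rn.
by rewrite !mxE eq_rshift eqxx.
Qed.

Let delta_mul (m : 'I_n) (c : 'cV[R[i]]_n) : ((delta_mx 0 m : 'rV_n) *m c) 0 0 = c m 0.
Proof. by rewrite -rowE mxE. Qed.

Lemma Omega_frame1_base b g p k :
  (-1) ^+ (lshift n (0 : 'I_1)) *
    Omega b g p (fun j => frame1 k (lift (lshift n (0 : 'I_1) : 'I_n.+1) j)) =
  (Num.sqrt (\det (g p)))%:C%C.
Proof.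
rewrite Omega_minor frame1_mx delta_lshift det_split det_bordered1 mul0mx.
by rewrite mxE subr0 mulr1.
Qed.

Lemma Omega_frame1_fibre b g p k m :
  (-1) ^+ (rshift 1 m) *
    Omega b g p (fun j => frame1 k (lift (rshift 1 m : 'I_n.+1) j)) =
  (Num.sqrt (\det (g p)))%:C%C * (- beta b g p m k).
Proof.
rewrite Omega_minor frame1_mx delta_rshift det_split det_bordered1 delta_mul.
by rewrite [col _ _ _ _]mxE sub0r.
Qed.

Lemma Omega_frame2_base b g p k j l :
  (-1) ^+ (lshift n (0 : 'I_1)) *
    Omega b g p (fun i => frame2 k j l (lift (lshift n (0 : 'I_1) : 'I_n.+1) i)) =
  (Num.sqrt (\det (g p)))%:C%C * beta b g p l j.
Proof.
rewrite Omega_minor frame2_mx delta_lshift det_split det_bordered2 !mul0mx.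
by rewrite ![(0 : 'M[R[i]]_(_, _)) _ _]mxE ![col _ _ _ _]mxE !subr0 mul0r subr0 mul1r.
Qed.

(** For [m == l] the omitted vector is [d/dy_j]: the quadratic part cancels and [- V beta_lk]
    remains, the counterpart of [V beta_lj] for the omission of [d/dy_k]. *)
Lemma Omega_frame2_fibre b g p k j l m :
  (-1) ^+ (rshift 1 m) *
    Omega b g p (fun i => frame2 k j l (lift (rshift 1 m : 'I_n.+1) i)) =
  (Num.sqrt (\det (g p)))%:C%C *
    (beta b g p m j * beta b g p l k - beta b g p m k * beta b g p l j
     - (m == l)%:R * beta b g p l k).
Proof.
rewrite Omega_minor frame2_mx delta_rshift det_split det_bordered2 !delta_mul.
rewrite ![col _ _ _ _]mxE [delta_mx _ _ _ _]mxE eqxx /= (eq_sym l m).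
by congr (_ * _); ring.
Qed.

(** [extd] has the sign outside [derivec], the computed values [F] have it inside; being real, it
    passes through the derivatives of both parts. *)
Lemma extd_parts (w : Defs.form E n) p (v : 'I_n.+1 -> E) (F : 'I_n.+1 -> E -> R[i]) :
  (forall (i : 'I_n.+1) q, (-1) ^+ i * w q (fun j => v (lift i j)) = F i q) ->
  (forall i, derivable (fun q => complex.Re (F i q)) p (v i)) ->
  (forall i, derivable (fun q => complex.Im (F i q)) p (v i)) ->
  extd w p v = 0 ->
  \sum_i 'D_(v i) (fun q => complex.Re (F i q)) p = 0 /\
  \sum_i 'D_(v i) (fun q => complex.Im (F i q)) p = 0.
Proof.
move=> wF dRe dIm w0.
have H (i : 'I_n.+1) : (-1) ^+ i *
    derivec (fun q => w q (fun j => v (lift i j))) (v i) p =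
  Complex ('D_(v i) (fun q => complex.Re (F i q)) p)
          ('D_(v i) (fun q => complex.Im (F i q)) p).
  have wE q : w q (fun j => v (lift i j)) = (-1) ^+ i * F i q.
    by rewrite -wF mulrA -expr2 sqrr_sign mul1r.
  have ReN (z : R[i]) : complex.Re (- z) = - complex.Re z by case: z.
  have ImN (z : R[i]) : complex.Im (- z) = - complex.Im z by case: z.
  rewrite (funext wE) /derivec -signr_odd; case: (odd i).
    rewrite expr1.
    have -> : (fun q => complex.Re (-1 * F i q)) = - (fun q => complex.Re (F i q)).
      by apply/funext => q; rewrite mulN1r ReN.
    have -> : (fun q => complex.Im (-1 * F i q)) = - (fun q => complex.Im (F i q)).
      by apply/funext => q; rewrite mulN1r ImN.
    by rewrite !deriveN// mulN1r; apply/eqP; rewrite eq_complex /= !opprK !eqxx.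
  rewrite expr0 mul1r; under eq_fun do rewrite mul1r.
  by under [X in Complex _ ('D__ X _)]eq_fun do rewrite mul1r.
move: w0; rewrite /extd; under eq_bigr do rewrite H.
have S (G K : 'I_n.+1 -> R) :
    \sum_i Complex (G i) (K i) = Complex (\sum_i G i) (\sum_i K i).
  by elim/big_rec3 : _ => // i x y z _ ->.
by rewrite S => -[].
Qed.

Lemma extd_split (w : Defs.form E n) p (v : 'I_(1 + n) -> E)
    (A0 B0 : E -> R) (A B : 'I_n -> E -> R) :
  (forall q, (-1) ^+ (lshift n (0 : 'I_1)) *
     w q (fun j => v (lift (lshift n (0 : 'I_1) : 'I_n.+1) j)) =
     Complex (A0 q) (B0 q)) ->
  (forall m q, (-1) ^+ (rshift 1 m) *
     w q (fun j => v (lift (rshift 1 m : 'I_n.+1) j)) =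
     Complex (A m q) (B m q)) ->
  derivable A0 p (v (lshift n 0)) -> derivable B0 p (v (lshift n 0)) ->
  (forall m, derivable (A m) p (v (rshift 1 m))) ->
  (forall m, derivable (B m) p (v (rshift 1 m))) ->
  extd w p v = 0 ->
  'D_(v (lshift n 0)) A0 p + \sum_m 'D_(v (rshift 1 m)) (A m) p = 0 /\
  'D_(v (lshift n 0)) B0 p + \sum_m 'D_(v (rshift 1 m)) (B m) p = 0.
Proof.
move=> w0 wr dA0 dB0 dA dB.
pose F (i : 'I_(1 + n)) q : R[i] := match fintype.split i with
  | inl _ => Complex (A0 q) (B0 q) | inr m => Complex (A m q) (B m q) end.
have Fl : F (lshift n 0) = fun q => Complex (A0 q) (B0 q).
  by apply/funext => q; rewrite /F (unsplitK (inl 0)).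
have Fr m : F (rshift 1 m) = fun q => Complex (A m q) (B m q).
  by apply/funext => q; rewrite /F (unsplitK (inr m)).
have wF (i : 'I_n.+1) q : (-1) ^+ i * w q (fun j => v (lift i j)) = F i q.
  case: (@split_ordP 1 n i) => m ->; rewrite ?ord1; first by rewrite w0 Fl.
  by rewrite wr Fr.
clearbody F.
have FP (P : 'I_(1 + n) -> Prop) : P (lshift n 0) ->
    (forall m : 'I_n, P (rshift 1 m)) ->
    forall i, P i.
  by move=> P0 Pr i; case: (@split_ordP 1 n i) => m ->; rewrite ?ord1.
have dRe : forall i, derivable (fun q => complex.Re (F i q)) p (v i).
  apply: (FP (fun i => derivable (fun q => complex.Re (F i q)) p (v i))) => [|m].
    by rewrite Fl; exact: dA0.
  by rewrite Fr; exact: dA.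
have dIm : forall i, derivable (fun q => complex.Im (F i q)) p (v i).
  apply: (FP (fun i => derivable (fun q => complex.Im (F i q)) p (v i))) => [|m].
    by rewrite Fl; exact: dB0.
  by rewrite Fr; exact: dB.
move=> /(extd_parts wF dRe dIm)[].
have sumE (G : 'I_(1 + n) -> R) :
    \sum_i G i = G (lshift n 0) + \sum_m G (rshift 1 m).
  by rewrite big_split_ord big_ord1.
rewrite !sumE Fl => HA HB; split.
- by rewrite -[RHS]HA; congr (_ + _); apply: eq_bigr => m _; rewrite Fr.
- by rewrite -[RHS]HB; congr (_ + _); apply: eq_bigr => m _; rewrite Fr.
Qed.

End HolomorphicVolume.

Arguments fibre_dir {R n}.
Arguments base_dir {R n}.
Arguments frame1 {R n}.
Arguments frame2 {R n}.

(** * The equations on frames with one and with two base vectors *)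

Section ClosedFlat.
Variables (R : realType) (n : nat).
Local Notation E := (('rV[R]_n * 'rV[R]_n)%type).
Variables (b g : E -> 'M[R]_n) (p : E).
Local Notation X k := (@fibre_dir R n k).
Local Notation Y k := (@base_dir R n k).
Local Notation V := (fun q => Num.sqrt (\det (g q))).
Local Notation bc i j := (fun q => b q i j).
Local Notation hc i j := (fun q => invmx (g q) i j).

Hypothesis dV : forall v, derivable V p v.
Hypothesis db : forall i j v, derivable (bc i j) p v.
Hypothesis dh : forall i j v, derivable (hc i j) p v.

(** Real and imaginary parts of one equation: the horizontal fields [Y k - \sum_m b_mk X m] and the
    columns of the inverse metric preserve the density [V] on the fibres. *)
Lemma closed_frame1 k : extd (Omega b g) p (frame1 k) = 0 ->
  'D_(Y k) V p = \sum_m 'D_(X m) (fun q => V q * b q m k) p /\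
  \sum_m 'D_(X m) (fun q => V q * invmx (g q) m k) p = 0.
Proof.
move=> ext0.
have dVb m v : derivable (fun q => V q * b q m k) p v by exact: derivableM.
have dVh m v : derivable (fun q => V q * invmx (g q) m k) p v by exact: derivableM.
have [q|m q|||m|m||HA HB] := @extd_split R n (Omega b g) p (frame1 k) V (cst 0)
  (fun m q => - (V q * b q m k)) (fun m q => - (V q * invmx (g q) m k)).
- by rewrite Omega_frame1_base.
- rewrite Omega_frame1_fibre mxE; apply/eqP; rewrite eq_complex /=.
  by apply/andP; split; apply/eqP; ring.
- exact: dV.
- exact: derivable_cst.
- exact: derivableN.
- exact: derivableN.
- exact: ext0.
rewrite frame1_base in HA; rewrite frame1_base derive_cst add0r in HB.
have N (f : 'I_n -> E -> R) : (forall m, derivable (f m) p (X m)) ->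
    \sum_m 'D_(frame1 k (rshift 1 m)) (fun q => - f m q) p =
    - \sum_m 'D_(X m) (f m) p.
  move=> df; rewrite -sumrN; apply: eq_bigr => m _.
  by rewrite frame1_fibre; exact: (@deriveN _ _ _ (f m) p (X m) (df m)).
rewrite (N (fun m q => V q * b q m k) (fun m => dVb m _)) in HA.
rewrite (N (fun m q => V q * invmx (g q) m k) (fun m => dVh m _)) in HB.
by split; apply/eqP; [rewrite -subr_eq0 HA|rewrite -oppr_eq0 HB].
Qed.

Lemma closed_frame2 k j l : extd (Omega b g) p (frame2 k j l) = 0 ->
  'D_(Y k) (fun q => V q * b q l j) p - 'D_(Y j) (fun q => V q * b q l k) p +
  \sum_m 'D_(X m) (fun q => V q *
    (b q m j * b q l k - invmx (g q) m j * invmx (g q) l k -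
     (b q m k * b q l j - invmx (g q) m k * invmx (g q) l j))) p = 0.
Proof.
move=> ext0.
pose A m q := V q *
    (b q m j * b q l k - invmx (g q) m j * invmx (g q) l k -
     (b q m k * b q l j - invmx (g q) m k * invmx (g q) l j)).
pose B m q := V q *
    (b q m j * invmx (g q) l k + invmx (g q) m j * b q l k -
     (b q m k * invmx (g q) l j + invmx (g q) m k * b q l j)).
have dVb i v : derivable (fun q => V q * b q l i) p v by exact: derivableM.
have dVh i v : derivable (fun q => V q * invmx (g q) l i) p v by exact: derivableM.
have dA m v : derivable (A m) p v.
  by apply: derivableM => //; apply: derivableB; apply: derivableB; apply: derivableM.
have dB m v : derivable (B m) p v.
  by apply: derivableM => //; apply: derivableB; apply: derivableD; apply: derivableM.
have [q|m q|||m|m||HA _] := @extd_split R n (Omega b g) p (frame2 k j l)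
  (fun q => V q * b q l j) (fun q => V q * invmx (g q) l j)
  (fun m q => if m == l then - (V q * b q l k) else A m q)
  (fun m q => if m == l then - (V q * invmx (g q) l k) else B m q).
- rewrite Omega_frame2_base mxE; apply/eqP; rewrite eq_complex /=.
  by apply/andP; split; apply/eqP; ring.
- rewrite Omega_frame2_fibre !mxE /A /B.
  have [->|_] := eqVneq m l; rewrite ?mul1r ?mul0r; apply/eqP;
    by rewrite eq_complex /=; apply/andP; split; apply/eqP; ring.
- exact: dVb.
- exact: dVh.
- by case: (m == l) => //; exact: derivableN.
- by case: (m == l) => //; exact: derivableN.
- exact: ext0.
rewrite frame2_base (bigD1 l)//= frame2_fibre eqxx deriveN// in HA.
rewrite -[RHS]HA -addrA (bigD1 l)//=.
congr (_ + (_ + _)).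
(* [A l] vanishes identically, so the sum may include [m = l], whose slot in the frame holds
   [d/dy_j]. *)
rewrite [T in T + _](_ : _ = 0) ?add0r; last first.
  rewrite (_ : (fun q => _) = cst 0) ?derive_cst//.
  by apply/funext => q /=; ring.
by apply: eq_bigr => m /negPf ml; rewrite frame2_fibre ml.
Qed.

End ClosedFlat.

(** * Restriction to a fibre *)

Section FibreRestriction.
Variables (R : realType) (n : nat).
Local Notation E := (('rV[R]_n * 'rV[R]_n)%type).
Implicit Types (f : E -> R) (x u y : 'rV[R]_n).

Lemma derive_fibre f x y u : 'D_((u, 0) : E) f (x, y) = 'D_u (fun z => f (z, y)) x.
Proof.
have E : (fun t : R => t^-1 *: ((f \o shift (x, y)) (t *: ((u, 0) : E)) - f (x, y))) =
    (fun t => t^-1 *: (((fun z => f (z, y)) \o shift x) (t *: u) - f (x, y))).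
  apply/funext => t /=; congr (_ *: (f _ - _)).
  by congr pair; rewrite /= scaler0 add0r.
by rewrite /derive E.
Qed.

Lemma differentiable_fibre f x y :
  differentiable f (x, y) -> differentiable (fun z => f (z, y)) x.
Proof.
move=> df; exact: (@differentiable_comp _ _ _ _ (fun z => (z, y) : E) f).
Qed.

Lemma derive_fibre_dir f p u : differentiable f p ->
  'D_((u, 0) : E) f p = \sum_m u 0 m * 'D_(fibre_dir m) f p.
Proof.
case: p => x y df; rewrite derive_fibre derive_basis; last exact: differentiable_fibre.
by apply: eq_bigr => m _; rewrite derive_fibre.
Qed.

Lemma iter_derive_fibre f y vs :
  iter_derive (fun z => f (z, y)) vs =
  fun z => iter_derive f [seq (v, 0) : E | v <- vs] (z, y).
Proof.
elim: vs f => [//|v vs IH] f /=.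
rewrite /iter_derive /= -!/(iter_derive _ _) -IH; congr iter_derive.
by apply/funext => z; rewrite derive_fibre.
Qed.

Lemma smooth_on_fibre (D : set E) f y : (forall x, D (x, y)) ->
  smooth_on D f -> smooth_on setT (fun z => f (z, y)).
Proof.
move=> Dy sf vs x _; rewrite iter_derive_fibre; apply: differentiable_fibre.
exact: sf.
Qed.

End FibreRestriction.

(** The products are already expanded by Leibniz's rule: [A], [A'] stand for the derivatives of [V]
    along [d/dy_k], [d/dy_j], and [u], [w] for those of [b_lj], [b_lk]. The two equations for [A]
    and [A'] and the two divergence equations remove all derivatives of [V], and flatness removes
    [u - w]. *)
Lemma commuting_columns_algebra (F : fieldType) n (V A A' u w : F) (dV : 'I_n -> F)
    (B H : 'M[F]_n) (dB dH : 'I_n -> 'I_n -> 'I_n -> F) (k j l : 'I_n) : V != 0 ->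
  A = \sum_m (dV m * B m k + V * dB m m k) ->
  A' = \sum_m (dV m * B m j + V * dB m m j) ->
  \sum_m (dV m * H m k + V * dH m m k) = 0 ->
  \sum_m (dV m * H m j + V * dH m m j) = 0 ->
  A * B l j + V * u - (A' * B l k + V * w) +
  \sum_m (dV m * (B m j * B l k - H m j * H l k - (B m k * B l j - H m k * H l j)) +
    V * (dB m m j * B l k + B m j * dB m l k - (dH m m j * H l k + H m j * dH m l k) -
      (dB m m k * B l j + B m k * dB m l j - (dH m m k * H l j + H m k * dH m l j)))) = 0 ->
  u - w - (\sum_m B m k * dB m l j - \sum_m B m j * dB m l k) = 0 ->
  \sum_m H m k * dH m l j = \sum_m H m j * dH m l k.
Proof.
move=> V0 AE A'E Hk Hj eq2 flat; apply/eqP; rewrite -subr_eq0.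
rewrite -(mulrI_eq0 _ (mulfI V0)); apply/eqP.
move: eq2; set S := \sum_m _ => eq2.
(* Collected by the undifferentiated factor, so that the first four sums are the divergences of the
   hypotheses. *)
have SE : S = B l k * (\sum_m (dV m * B m j + V * dB m m j)) -
    H l k * (\sum_m (dV m * H m j + V * dH m m j)) -
    (B l j * (\sum_m (dV m * B m k + V * dB m m k)) -
     H l j * (\sum_m (dV m * H m k + V * dH m m k))) +
    V * (\sum_m B m j * dB m l k - \sum_m H m j * dH m l k -
      (\sum_m B m k * dB m l j - \sum_m H m k * dH m l j)).
  rewrite -!sumrB !mulr_sumr -!sumrB -big_split /=.
  by apply: eq_bigr => m _; ring.
move: flat eq2; rewrite -AE -A'E Hk Hj in SE; rewrite SE !mulr0 !subr0.
set a := \sum_m B m k * _; set a' := \sum_m B m j * _.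
set c := \sum_m H m k * _; set c' := \sum_m H m j * _ => flat eq2.
have uE : u = w + (a - a') by rewrite -[LHS]subr0 -flat; ring.
by rewrite -[RHS]eq2 uE; ring.
Qed.

Section DeriveQuadratic.
Variables (R : realType) (V : normedModType R) (p v : V).

Lemma derive_sub (f g : V -> R) : derivable f p v -> derivable g p v ->
  'D_v (fun q => f q - g q) p = 'D_v f p - 'D_v g p.
Proof. by move=> df dg; exact: (@deriveB _ _ _ f g). Qed.

Lemma derive_quadratic (s a a' c c' d d' e e' : V -> R) :
  derivable s p v -> derivable a p v -> derivable a' p v ->
  derivable c p v -> derivable c' p v -> derivable d p v -> derivable d' p v ->
  derivable e p v -> derivable e' p v ->
  'D_v (fun q => s q * (a q * a' q - c q * c' q - (d q * d' q - e q * e' q))) p =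
  'D_v s p * (a p * a' p - c p * c' p - (d p * d' p - e p * e' p)) +
  s p * ('D_v a p * a' p + a p * 'D_v a' p - ('D_v c p * c' p + c p * 'D_v c' p) -
    ('D_v d p * d' p + d p * 'D_v d' p - ('D_v e p * e' p + e p * 'D_v e' p))).
Proof.
move=> ds da da' dc dc' dd dd' de de'.
have dM (f h : V -> R) : derivable f p v -> derivable h p v ->
    derivable (fun q => f q * h q) p v.
  by move=> df dh; exact: (derivableM df dh).
have dB (f h : V -> R) : derivable f p v -> derivable h p v ->
    derivable (fun q => f q - h q) p v.
  by move=> df dh; exact: (derivableB df dh).
have da2 := dM _ _ da da'; have dc2 := dM _ _ dc dc'.
have dd2 := dM _ _ dd dd'; have de2 := dM _ _ de de'.
rewrite (derive_mul ds (dB _ _ (dB _ _ da2 dc2) (dB _ _ dd2 de2))).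
rewrite (derive_sub (dB _ _ da2 dc2) (dB _ _ dd2 de2)).
rewrite (derive_sub da2 dc2) (derive_sub dd2 de2).
by rewrite (derive_mul da da') (derive_mul dc dc') (derive_mul dd dd') (derive_mul de de').
Qed.

End DeriveQuadratic.

(** * Total symmetry of the derivatives and constancy of the fibre volume *)

Section CommutingColumns.
Variables (R : realType) (n : nat).
Local Notation E := (('rV[R]_n * 'rV[R]_n)%type).
Variables (b g : E -> 'M[R]_n) (p : E).
Local Notation X k := (@fibre_dir R n k).
Local Notation Y k := (@base_dir R n k).
Local Notation V := (fun q => Num.sqrt (\det (g q))).
Local Notation bc i j := (fun q => b q i j).
Local Notation hc i j := (fun q => invmx (g q) i j).

Hypothesis det_gt0 : 0 < \det (g p).
Hypothesis gu : \near p, g p \in unitmx.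
Hypothesis db : forall i j, differentiable (bc i j) p.
Hypothesis dg : forall i j, differentiable (fun q => g q i j) p.
Hypothesis closed : forall v, extd (Omega b g) p v = 0.

Let dV v : derivable V p v.
Proof. by apply/diff_derivable/differentiable_sqrt_det. Qed.

Let dbv i j v : derivable (bc i j) p v.
Proof. exact: diff_derivable. Qed.

Let dhv i j v : derivable (hc i j) p v.
Proof. exact: derivable_invmx. Qed.

Lemma curvatureE k j l : connection_curvature b k j p 0 l =
  'D_(Y k) (bc l j) p - 'D_(Y j) (bc l k) p -
  (\sum_m b p m k * 'D_(X m) (bc l j) p - \sum_m b p m j * 'D_(X m) (bc l k) p).
Proof.
have vertD i v : ('D_v (vert b i) p) 0 l = 'D_v (bc l i) p.
  rewrite derive_mx; last first.
    apply/derivable_mxP => r s; under eq_fun do rewrite mxE.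
    exact: dbv.
  by rewrite mxE; under eq_fun do rewrite mxE.
have subE (a c d e : 'rV[R]_n) :
    (a - c - (d - e)) 0 l = a 0 l - c 0 l - (d 0 l - e 0 l) by rewrite !mxE.
rewrite /connection_curvature /fibre_bracket subE.
have fibreD (i s : 'I_n) : ('D_((vert b i p, 0) : E) (vert b s) p) 0 l =
    \sum_m b p m i * 'D_(X m) (bc l s) p.
  apply: etrans (vertD s _) _; rewrite (derive_fibre_dir (vert b i p) (db l s)).
  by apply: eq_bigr => m _; rewrite mxE.
congr (_ - _ - (_ - _)); [exact: vertD|exact: vertD|exact: fibreD|exact: fibreD].
Qed.

Lemma inverse_columns_commute k j l : connection_curvature b k j p = 0 ->
  \sum_m invmx (g p) m k * 'D_(X m) (hc l j) p =
  \sum_m invmx (g p) m j * 'D_(X m) (hc l k) p.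
Proof.
move=> /matrixP/(_ 0 l); rewrite curvatureE [RHS]mxE => flat.
have [AE Hk] := closed_frame1 dV dbv dhv (closed (frame1 k)).
have [A'E Hj] := closed_frame1 dV dbv dhv (closed (frame1 j)).
have eq2 := closed_frame2 dV dbv dhv (closed (frame2 k j l)).
have mulE (f : E -> R) v : derivable f p v ->
    'D_v (fun q => V q * f q) p = 'D_v V p * f p + V p * 'D_v f p.
  by move=> df; exact: (@derive_mul _ _ V f p v (@dV v) df).
have sumE (f : 'I_n -> E -> R) : (forall m, derivable (f m) p (X m)) ->
    \sum_m 'D_(X m) (fun q => V q * f m q) p =
    \sum_m ('D_(X m) V p * f m p + V p * 'D_(X m) (f m) p).
  by move=> df; apply: eq_bigr => m _; exact: mulE.
have V0 : V p != 0 by rewrite gt_eqF// sqrtr_gt0.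
apply: (@commuting_columns_algebra R n (V p) ('D_(Y k) V p) ('D_(Y j) V p)
  ('D_(Y k) (bc l j) p) ('D_(Y j) (bc l k) p) (fun m => 'D_(X m) V p)
  (b p) (invmx (g p)) (fun m i s => 'D_(X m) (bc i s) p)
  (fun m i s => 'D_(X m) (hc i s) p) k j l V0).
- by apply: etrans AE _; exact: sumE.
- by apply: etrans A'E _; exact: sumE.
- by apply: etrans Hk; apply: esym; exact: (sumE (fun m => hc m k)).
- by apply: etrans Hj; apply: esym; exact: (sumE (fun m => hc m j)).
- apply: etrans eq2; congr (_ - _ + _).
  + by apply: esym; exact: mulE.
  + by apply: esym; exact: mulE.
  apply: eq_bigr => m _; apply: esym.
  exact: (@derive_quadratic _ _ p (X m) V (bc m j) (bc l k) (hc m j) (hc l k)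
    (bc m k) (bc l j) (hc m k) (hc l j)).
- exact: flat.
Qed.


Hypothesis ginv_sym : (invmx (g p))^T = invmx (g p).
Hypothesis flat : forall k j, connection_curvature b k j p = 0.

Let hg : invmx (g p) *m g p = 1%:M.
Proof. by rewrite mulVmx//; exact: nbhs_singleton gu. Qed.

Lemma closed_flat_curl l a c :
  derive_entries (X l) g p a c = derive_entries (X c) g p a l.
Proof.
apply: (curl_free_inverse (Y := fun l => derive_entries (X l) g p) hg) => // i j k.
apply: oppr_inj; rewrite -!sumrN.
have := inverse_columns_commute i (flat k j).
have E s t m : invmx (g p) m t * 'D_(X m) (hc i s) p =
    - (invmx (g p) m t * (invmx (g p) *m derive_entries (X m) g p *m invmx (g p)) i s).
  by rewrite -mulrN; congr (_ * _); exact: derive_invmx.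
by under eq_bigr do rewrite E; under [in RHS]eq_bigr do rewrite E.
Qed.

(** In the divergence of [V] times column [k] of the inverse, the derivatives of [V] contribute half
    of [V p] times entry [k] of [T *m invmx (g p)], and those of the inverse, by total symmetry,
    minus the whole of it. So [- V p / 2] times that entry vanishes. *)
Lemma closed_flat_trace m : \tr (invmx (g p) *m derive_entries (X m) g p) = 0.
Proof.
pose T : 'rV[R]_n := \row_m \tr (invmx (g p) *m derive_entries (X m) g p).
suff T0 : T *m invmx (g p) = 0.
  have : T = 0 by rewrite -[T]mulmx1 -hg mulmxA T0 mul0mx.
  by move=> /rowP/(_ m); rewrite !mxE.
apply/rowP => k; rewrite [RHS]mxE.
have [_ Hk] := closed_frame1 dV dbv dhv (closed (frame1 k)).
have V0 : V p / 2 != 0 by rewrite gt_eqF// divr_gt0// sqrtr_gt0.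
apply: (mulfI V0); rewrite mulr0; apply: oppr_inj; rewrite oppr0 -[RHS]Hk.
have E s : 'D_(X s) (fun q => V q * hc s k q) p =
    V p * T 0 s / 2 * invmx (g p) s k -
    V p * (invmx (g p) *m derive_entries (X s) g p *m invmx (g p)) s k.
  apply: etrans (@derive_mul _ _ V (hc s k) p (X s) (@dV _) (@dhv _ _ _)) _.
  rewrite -mulrN; congr (_ * _ + _ * _); last exact: derive_invmx.
  by rewrite mxE; exact: derive_sqrt_det.
under [RHS]eq_bigr do rewrite E.
rewrite sumrB -mulr_sumr (curl_free_divergence _ _ closed_flat_curl).
rewrite mxE !mulr_sumr -sumrB -sumrN; apply: eq_bigr => s _.
by rewrite [T 0 s]mxE; field.
Qed.

End CommutingColumns.
(** * Invariance under the lattice *)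

Section TranslationInvariance.
Variables (R : realType) (n : nat).
Local Notation E := (('rV[R]_n * 'rV[R]_n)%type).
Implicit Types (b g : E -> 'M[R]_n) (p u v : E) (s : 'rV[R]_n -> 'rV[R]_n).

Lemma derive_pair (U W W' : normedModType R) (f : U -> W) (f' : U -> W') (x w : U) :
  derivable f x w -> derivable f' x w ->
  'D_w (fun z => (f z, f' z)) x = ('D_w f x, 'D_w f' x).
Proof.
move=> df df'; apply: cvg_lim => //.
exact: (cvg_pair (F := 0^') df df').
Qed.

Lemma derive_translate_section s p v : differentiable s p.2 ->
  'D_v (translate s) p = (v.1 + 'D_v.2 s p.2, v.2).
Proof.
move=> ds.
have fstE : (fun t : R => t^-1 *: ((fst \o shift p) (t *: v) - p.1)) =
    (fun t => t^-1 *: ((id \o shift p.1) (t *: v.1) - id p.1)) by [].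
have sndE (f : 'rV[R]_n -> 'rV[R]_n) :
    (fun t : R => t^-1 *: (((f \o snd) \o shift p) (t *: v) - (f \o snd) p)) =
    (fun t => t^-1 *: ((f \o shift p.2) (t *: v.2) - f p.2)) by [].
have d1 : derivable (fst : E -> _) p v.
  by rewrite /derivable fstE; exact: derivable_id.
have D1 : 'D_v (fst : E -> _) p = v.1.
  by rewrite /derive fstE; exact: derive_id.
have d2 (f : 'rV[R]_n -> 'rV[R]_n) : derivable f p.2 v.2 -> derivable (f \o snd) p v.
  by move=> df; rewrite /derivable sndE.
have D2 (f : 'rV[R]_n -> 'rV[R]_n) : 'D_v (f \o snd) p = 'D_v.2 f p.2.
  by rewrite /derive sndE.
have ds2 : derivable s p.2 v.2 by exact: diff_derivable.
have d3 : derivable (id \o snd : E -> _) p v by apply: d2; exact: derivable_id.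
have := derive_pair (derivableD d1 (d2 s ds2)) d3.
by rewrite (deriveD d1 (d2 s ds2)) D1 !D2 derive_id.
Qed.

(** Exchanging one vector of the fibre frame isolates [V * theta_l]; then [u = d/dx_l] yields [V],
    and [u = d/dy_m] yields [V * beta_lm]. *)
Lemma Omega_vertical b g p l u :
  Omega b g p (fun j => if j == l then u else fibre_dir j) =
  (Num.sqrt (\det (g p)))%:C%C * theta b g l p u.
Proof.
rewrite /Omega /wedge; congr (_ * _).
pose c : 'cV[R[i]]_n := \col_r theta b g r p u.
have -> : theta b g l p u = c l 0 by rewrite mxE.
rewrite -det_col_replaced; congr (\det _); apply/matrixP => r j.
rewrite [LHS]mxE [RHS]mxE [X in _ + X]mxE big_ord1 !mxE eqxx /=.
have [->|/negPf jl] := eqVneq j l.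
  by rewrite mulr1 andbT [RHS]addrC subrK.
by rewrite mulr0 addr0 theta_fibre.
Qed.

(** The translation fixes the vectors [d/dx_j], hence preserves [V]; it shears [d/dy_m] by a
    derivative of [s], which is real, so only [b] is shifted and the imaginary part of [beta] is
    preserved. *)
Lemma translation_invariant_metric b g s p : 0 < \det (g p) ->
  differentiable s p.2 ->
  (forall v : 'I_n -> E, pullback (translate s) (Omega b g) p v = Omega b g p v) ->
  invmx (g (translate s p)) = invmx (g p).
Proof.
move=> det0 ds inv; apply/matrixP => l m.
have push u :
    (fun j : 'I_n => 'D_(if j == l then u else fibre_dir j) (translate s) p) =
    fun j => if j == l then (u.1 + 'D_u.2 s p.2, u.2) : E else fibre_dir j.
  apply/funext => j; case: ifP => _; rewrite derive_translate_section//=.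
  by rewrite derive0 addr0.
have {}inv u : (Num.sqrt (\det (g (translate s p))))%:C%C *
      theta b g l (translate s p) (u.1 + 'D_u.2 s p.2, u.2) =
    (Num.sqrt (\det (g p)))%:C%C * theta b g l p u.
  by rewrite -!Omega_vertical -inv /pullback push.
have V0 : Num.sqrt (\det (g p)) != 0 by rewrite gt_eqF// sqrtr_gt0.
have := inv (fibre_dir l).
have -> : ((fibre_dir l).1 + 'D_(fibre_dir l).2 s p.2, (fibre_dir l).2) =
    fibre_dir l :> E.
  by rewrite /= derive0 addr0.
rewrite !theta_fibre eqxx !mulr1 => -[VE].
have := inv (base_dir m).
have -> : theta b g l (translate s p)
    ((base_dir m).1 + 'D_(base_dir m).2 s p.2, (base_dir m).2) =
    ('D_(delta_mx 0 m) s p.2 0 l)%:C%C + beta b g (translate s p) l m.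
  by rewrite -theta_base /theta /= !mxE !add0r.
rewrite theta_base VE !mxE => /eqP; rewrite eq_complex /= => /andP[_ /eqP].
by rewrite !mul0r !addr0 add0r => /(mulfI V0).
Qed.

End TranslationInvariance.

Section LocalSections.
Variables (R : realType) (n : nat) (B : topologicalType) (A : atlas R n B).
Variable Lam : A -> set (phase R n).
Hypothesis Lam_lagrangian : lagrangian_family Lam.

(** [lam_lagrangian] controls [Lam] near a point of the total space, whereas [global_form] asks for
    a section lying in [Lam] over its whole domain; continuity of [s] allows the domain to be shrunk
    accordingly. *)
Lemma section_through a x y : Lam a (x, y) ->
  exists (W : set 'rV[R]_n) (s : 'rV[R]_n -> 'rV[R]_n),
    [/\ open W, W y, W `<=` chart_img a, smooth_on W s &
        s y = x /\ forall z, W z -> Lam a (s z, z)].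
Proof.
move=> Lxy; have [W [s [Wo Wy Wa [ss _] near_s]]] := lam_lagrangian Lam_lagrangian Lxy.
have sy : x = s y by have /= [/(_ Lxy)] := nbhs_singleton near_s.
pose N := [set z | Lam a (s z, z)].
have Ny : nbhs y N.
  have cs : {for y, continuous (fun z => (s z, z))}.
    apply: differentiable_continuous; apply: differentiable_pair => //.
    exact: (ss [::]).
  rewrite {1}sy in near_s.
  have : nbhs y [set z | Lam a (s z, z) <-> s z = s z] by exact: cs near_s.
  by apply: filterS => z /= [_]; exact.
exists (W `&` N°), s; split=> //.
- by apply: openI => //; exact: open_interior.
- by move=> z [/Wa].
- by move=> vs z [Wz _]; exact: ss.
- by split=> // z [_ /interior_subset].
Qed.

End LocalSections.

Lemma flat_metric_const (R : realType) n (h : 'rV[R]_n -> 'M[R]_n) :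
  (forall x, h x = h 0) -> flat_metric h.
Proof.
move=> hc l k i j x.
have partial_cst (c : R) m z : partial (fun=> c) m z = 0 by exact: derive_cst.
have chr r s t : christoffel h r s t = cst 0.
  apply/funext => z; rewrite /christoffel big1 ?mulr0// => m _.
  have E c d : (fun w => h w c d) = fun=> h 0 c d by apply/funext => w; rewrite hc.
  by rewrite !E !partial_cst addr0 subr0 mulr0.
rewrite /riemann !chr !partial_cst subrr add0r big1// => m _.
by rewrite !chr mul0r subrr.
Qed.

(** * From the fibres over [B0] to all fibres *)

Theorem corollary5p16 (R : realType) (n : nat) (n_gt0 : (0 < n)%N)
    (B : topologicalType) (A : atlas R n B)
    (B_hausdorff : hausdorff_space B) (B_compact : compact [set: B])
    (Lam : A -> set (phase R n)) (Lam_lagrangian : lagrangian_family Lam)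
    (B0 : set B) (B0_open : open B0) (B0_dense : dense B0)
    (Lam_lattice : lattice_over Lam B0)
    (b g : A -> phase R n -> 'M[R]_n)
    (b_smooth : forall a i j, smooth_on (cot_dom a) (fun p => b a p i j))
    (g_smooth : forall a i j, smooth_on (cot_dom a) (fun p => g a p i j))
    (g_unit : forall a p, cot_dom a p -> g a p \in unitmx)
    (ginv_pos : forall a p, cot_dom a p -> pos_def (invmx (g a p)))
    (beta_sym : forall a p, cot_dom a p ->
       (beta (b a) (g a) p)^T = beta (b a) (g a) p)
    (Omega_global : global_form Lam (fun a => Omega (b a) (g a)))
    (Omega_closed : forall a p v, cot_dom a p ->
       extd (Omega (b a) (g a)) p v = 0)
    (b_flat : forall a k j p, cot_dom a p ->
       connection_curvature (b a) k j p = 0) :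
  forall (a : A) (y : 'rV[R]_n), chart_img a y ->
    flat_metric (fun x => g a (x, y)).
Proof.
have cot_nbhs (a : A) p : cot_dom a p -> nbhs p (cot_dom a).
  move=> Dp; have img_nbhs : nbhs p.2 (chart_img a).
    by apply: open_nbhs_nbhs; split; [exact: chart_img_open|].
  by case: p Dp img_nbhs => x y _; exact: cvg_snd.
have hT (a : A) p : cot_dom a p -> (invmx (g a p))^T = invmx (g a p).
  move=> /beta_sym/matrixP bT; apply/matrixP => i j.
  by have := bT i j; rewrite !mxE => -[].
have gT (a : A) p : cot_dom a p -> (g a p)^T = g a p.
  by move=> /hT; rewrite trmx_inv => /(congr1 (@invmx _ n)); rewrite !invmxK.
have det0 (a : A) p : cot_dom a p -> 0 < \det (g a p).
  move=> Dp; rewrite -invr_gt0 -det_inv; apply: pos_def_det_gt0; first exact: hT.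
    by rewrite unitmx_inv; exact: g_unit.
  exact: ginv_pos.
have db (a : A) p i j : cot_dom a p -> differentiable (fun q => b a q i j) p.
  exact: (b_smooth a i j [::]).
have dg (a : A) p i j : cot_dom a p -> differentiable (fun q => g a q i j) p.
  exact: (g_smooth a i j [::]).
have gu (a : A) p : cot_dom a p -> \near p, g a p \in unitmx.
  by move=> /cot_nbhs; apply: filterS => q; exact: g_unit.
have curl (a : A) p l r s : cot_dom a p ->
    derive_entries (fibre_dir l) (g a) p r s = derive_entries (fibre_dir s) (g a) p r l.
  move=> Dp; apply: (@closed_flat_curl R n (b a) (g a) p) => //.
  - exact: det0.
  - exact: gu.
  - by move=> i j; exact: db.
  - by move=> i j; exact: dg.
  - by move=> v; exact: Omega_closed.
  - exact: hT.
  - by move=> k j; exact: b_flat.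
have trace (a : A) p s : cot_dom a p ->
    \tr (invmx (g a p) *m derive_entries (fibre_dir s) (g a) p) = 0.
  move=> Dp; apply: (@closed_flat_trace R n (b a) (g a) p) => //.
  - exact: det0.
  - exact: gu.
  - by move=> i j; exact: db.
  - by move=> i j; exact: dg.
  - by move=> v; exact: Omega_closed.
  - exact: hT.
  - by move=> k j; exact: b_flat.
have const0 (a : A) q x : chart_dom a q -> B0 q ->
    g a (x, chart a q) = g a (0, chart a q).
  move=> Dq B0q; set y := chart a q.
  have Dxy z : cot_dom a (z, y) by exists q.
  have [M Mu LM] := Lam_lattice a q Dq B0q.
  have fibreE v z : derive_entries v (fun z => g a (z, y)) z =
      derive_entries ((v, 0) : phase R n) (g a) (z, y).
    by apply/matrixP => i j; rewrite !mxE derive_fibre.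
  apply: (@fibre_metric_const R n M (fun z => g a (z, y)) Mu) => //.
  (* A lattice vector is a point over [y] alone; translating the form requires its extension to a
     local section through that point. *)
  - move=> i j k z; have : Lam a (map_mx intr k *m M, y).
      have : [set x | Lam a (x, chart a q)] (map_mx intr k *m M) by rewrite LM; exists k.
      by [].
    move=> /(section_through Lam_lagrangian)[W [s [Wo Wy Wa Ws [sy Ls]]]].
    have inv := Omega_global.2 a W s Wo Wa Ws Ls (z, y).
    have := @translation_invariant_metric R n (b a) (g a) s (z, y)
      (det0 _ _ (Dxy z)) (Ws [::] y Wy) (fun v => inv v Wy).
    by rewrite /translate /= sy => /(congr1 (@invmx _ n)); rewrite !invmxK => ->.
  - by move=> i j; apply: smooth_on_fibre (g_smooth a i j) => z; exact: Dxy.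
  - by move=> z; exact: g_unit.
  - by move=> z; exact: gT.
  - by move=> z; exact: ginv_pos.
  - by move=> z l r s; rewrite !fibreE; exact: curl.
  - by move=> z s; rewrite fibreE; exact: trace.
move=> a y [q0 Dq0 <-]; apply: flat_metric_const => x.
apply/matrixP => i j; apply/eqP; rewrite -subr_eq0; apply/negPn/negP => ne0.
(* With [x] and the entry fixed, a nonzero difference at [q0] persists over a neighbourhood in [B],
   which contains a point of [B0]. *)
pose f y := g a (x, y) i j - g a (0, y) i j.
have cf : {for chart a q0, continuous f}.
  have d z : differentiable (fun y => g a (z, y) i j) (chart a q0).
    apply: (@differentiable_comp _ _ _ _ (fun y => (z, y) : phase R n) (fun p => g a p i j)).
      by apply: differentiable_pair.
    by apply: dg; exists q0.
  exact/differentiable_continuous/differentiableB.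
have fne0 : \forall y \near chart a q0, f y != 0.
  exact: (cvgr_neq0 _ cf ne0).
have : nbhs q0 (chart_dom a `&` [set q | f (chart a q) != 0]).
  apply: filterI; first exact: open_nbhs_nbhs (conj (chart_dom_open a) Dq0).
  exact: (chart_cont Dq0 fne0).
rewrite nbhsE => -[U [Uo Uq0] subU].
have [q [Uq B0q]] := B0_dense U (ex_intro _ q0 Uq0) Uo.
have [Dq] := subU _ Uq.
by rewrite /= /f const0// subrr eqxx.
Qed.
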